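(* Let $n\geq 1$, let $H$ be any graph, and let $S=K[V(S_n\odot H)]$, where $S_n$ is the $n$-star. Then $$\operatorname{reg}(S/I(S_n\odot H))=\begin{cases}n, & \text{if } H \text{ is a null graph};\\ (n+1)\cdot\operatorname{reg}(K[V(H)]/I(H)), & \text{otherwise}.\end{cases}$$
   Context: $K$ is a field. All graphs are finite, simple, have nonempty vertex set, and may have isolated vertices. Vertices of a graph $G$ are identified with the variables of the standard graded polynomial ring $K[V(G)]$. A null graph is a graph with no edges. Edge ideal convention: $I(G)\subset K[V(G)]$ is the ideal generated by all products $x_ix_j$ with $\{x_i,x_j\}\in E(G)$ together with all variables $x_k$ with $x_k$ an isolated vertex of $G$. (Thus $K[V(H)]/I(H)\cong K[V(H')]/I(H')$, where $H'$ is the induced subgraph of $H$ on the non-isolated vertices.) The corona product $X\odot H$ is the graph obtained from one copy of $X$ and $|V(X)|$ disjoint copies of $H$, namely $H_1,\dots,H_{|V(X)|}$, by joining the $i$-th vertex of $X$ to every vertex of $H_i$. It has no isolated vertices, so $I(X\odot H)$ is the usual edge ideal. For $k\geq 1$, the $k$-star $S_k$ is the tree on $k+1$ vertices consisting of one vertex joined to each of $k$ other vertices (and no other edges). $\operatorname{reg}(A)=\max\{j-i:\beta_{i,j}(A)\neq0\}$ is the Castelnuovo–Mumford regularity, where $\beta_{i,j}(A)$ are the graded Betti numbers of the finitely generated graded module $A$ over the corresponding polynomial ring. *)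

(* Defs.v *)
From Stdlib Require Import ClassicalEpsilon.
From HB Require Import structures.
From mathcomp Require Import all_boot all_order all_algebra.
From mathcomp Require Import mpoly.

Set Implicit Arguments.
Unset Strict Implicit.
Unset Printing Implicit Defensive.

Import GRing.Theory Num.Theory.
Local Open Scope ring_scope.

Record sgraph := SGraph {
  vertex :> finType;
  adj : rel vertex;
  adj_sym : ssrbool.symmetric adj;
  adj_irr : irreflexive adj }.

Definition isolated (G : sgraph) (v : G) : bool := [forall u, ~~ adj v u].

Definition null_graph (G : sgraph) : bool := [forall u : G, forall v : G, ~~ adj u v].

(** [k]-star: the vertex [ord0] of ['I_k.+1] is the centre. *)

Definition star_adj (k : nat) : rel 'I_k.+1 :=
  fun u v => (u == ord0) (+) (v == ord0).

Lemma star_adj_sym k : ssrbool.symmetric (@star_adj k).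
Proof. by move=> u v; rewrite /star_adj addbC. Qed.

Lemma star_adj_irr k : irreflexive (@star_adj k).
Proof. by move=> u; rewrite /star_adj addbb. Qed.

Definition star (k : nat) : sgraph :=
  SGraph (@star_adj_sym k) (@star_adj_irr k).

(** Corona product: [inl x] is the vertex [x] of the copy of [X], and
    [inr (x, h)] is the vertex [h] of the copy of [H] attached to [x]. *)

Definition corona_adj (X H : sgraph) : rel (X + X * H)%type :=
  fun u v =>
    match u, v with
    | inl x, inl y => adj x y
    | inl x, inr (y, _) => x == y
    | inr (x, _), inl y => x == y
    | inr (x, h), inr (y, k) => (x == y) && adj h k
    end.

Lemma corona_adj_sym X H : ssrbool.symmetric (@corona_adj X H).
Proof.
by move=> [x|[x h]] [y|[y k]] //=; rewrite ?(eq_sym y) // adj_sym.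
Qed.

Lemma corona_adj_irr X H : irreflexive (@corona_adj X H).
Proof. by move=> [x|[x h]] /=; rewrite adj_irr ?andbF. Qed.

Definition corona (X H : sgraph) : sgraph :=
  SGraph (@corona_adj_sym X H) (@corona_adj_irr X H).

Definition ideal_gen (R : comNzRingType) (g : R -> Prop) (p : R) : Prop :=
  exists2 s : seq (R * R),
    (forall c, c \in s -> g c.2) & p = \sum_(c <- s) c.1 * c.2.

(** [K[V(G)]] is [{mpoly K[#|G|]}], with [enum_rank] numbering the vertices. *)

Definition vvar (K : fieldType) (G : sgraph) (v : G) : {mpoly K[#|G|]} :=
  'X_(enum_rank v).

Definition edge_ideal (K : fieldType) (G : sgraph) : {mpoly K[#|G|]} -> Prop :=
  ideal_gen (fun p =>
       (exists u v : G, adj u v /\ p = vvar K u * vvar K v)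
    \/ (exists v : G, isolated v /\ p = vvar K v)).

(** A sequence of graded free modules and maps
      ... -> F_2 -> F_1 -> F_0 -> S,   S = K[x_1, ..., x_n].
    [F_i] has a basis of [frank i] elements, the [k]-th being of degree
    [fdeg i k]; its elements are row vectors, on which the matrix of
    [fdiff i : F_(i+1) -> F_i] acts on the right.  The last map [faug] lifts
    the augmentation [F_0 -> S/I]. *)

Record free_seq (K : fieldType) (n : nat) := FreeSeq {
  frank : nat -> nat;
  fdeg : forall i : nat, 'I_(frank i) -> nat;
  fdiff : forall i : nat, 'M[{mpoly K[n]}]_(frank i.+1, frank i);
  faug : 'cV[{mpoly K[n]}]_(frank 0) }.

(** The maps are homogeneous of degree 0.  The condition on [fdiff] forces an
    entry to vanish when its target generator has the larger degree. *)

Definition is_graded (K : fieldType) (n : nat) (F : free_seq K n) : Prop :=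
  (forall i (k : 'I_(frank F i.+1)) (l : 'I_(frank F i)) (m : 'X_{1..n}),
      m \in msupp (fdiff F i k l) -> (mdeg m + fdeg l)%N = fdeg k)
  /\ (forall (k : 'I_(frank F 0)) (m : 'X_{1..n}),
      m \in msupp (faug F k ord0) -> mdeg m = fdeg k).

(** [... -> F_1 -> F_0 -> S/I -> 0] is exact. *)

Definition is_resolution (K : fieldType) (n : nat)
    (I : {mpoly K[n]} -> Prop) (F : free_seq K n) : Prop :=
  [/\ forall p : {mpoly K[n]},
        exists u : 'rV_(frank F 0), I (p - (u *m faug F) ord0 ord0),
      forall u : 'rV_(frank F 0),
        I ((u *m faug F) ord0 ord0) <-> exists w, u = w *m fdiff F 0
    & forall i (u : 'rV_(frank F i.+1)),
        u *m fdiff F i = 0 <-> exists w, u = w *m fdiff F i.+1].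

(** The image of [F_(i+1)] lies in [(x_1, ..., x_n) F_i]. *)

Definition is_minimal (K : fieldType) (n : nat) (F : free_seq K n) : Prop :=
  forall i (k : 'I_(frank F i.+1)) (l : 'I_(frank F i)),
    (fdiff F i k l)@_0%MM = 0.

Definition minimal_resolution (K : fieldType) (n : nat)
    (I : {mpoly K[n]} -> Prop) (F : free_seq K n) : Prop :=
  [/\ is_graded F, is_resolution I F & is_minimal F].

(** For a homogeneous ideal [I] a minimal graded free resolution of [S/I]
    exists and is unique up to isomorphism, so that the number chosen below
    is the multiplicity of [S(-j)] in [F_i]. *)

Definition betti (K : fieldType) (n : nat) (I : {mpoly K[n]} -> Prop)
    (i j : nat) : nat :=
  epsilon (inhabits 0%N) (fun b =>
    exists F : free_seq K n, minimal_resolution I F /\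
      b = #|[set k : 'I_(frank F i) | fdeg k == j]|).

Definition is_max (P : int -> Prop) (r : int) : Prop :=
  P r /\ forall s, P s -> s <= r.

(** [reg I] is the regularity of the module [S/I], not of the ideal [I]. *)

Definition reg (K : fieldType) (n : nat) (I : {mpoly K[n]} -> Prop) : int :=
  epsilon (inhabits 0) (is_max (fun r =>
    exists i j : nat, betti I i j <> 0%N /\ r = j%:Z - i%:Z)).

(* Main.v *)
Require Import Defs.
From Stdlib Require Import Classical ClassicalEpsilon.
From Stdlib Require Import FunctionalExtensionality PropExtensionality.
From mathcomp Require Import all_boot all_order all_algebra.
From mathcomp Require Import mpoly zify ring.

(** Why the theorem is true.

    The edge ideal is a squarefree monomial ideal, so that Hochster's formula applies:
    the Betti number [(i, j)] of [S/I(G)] is nonzero if and only if, for some set [W] of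
    [j] vertices, the complex of independent subsets of [W] without isolated vertices of
    [G] has reduced cohomology on faces with [j - i] vertices ([betti_neq0]).  Hence the
    regularity of [S/I(G)] is the largest [r] such that some [W] has reduced cohomology on
    faces with [r] vertices ([reg_homological]), and the theorem becomes a statement about
    independence complexes ([star_corona_top]).

    Upper bounds come from the exact sequence of the deletion and the link of a vertex
    ([reg_le_del_link]) and from the Kuenneth formula, by which regularities add up over
    disjoint unions ([join_acyclic]).  Deleting a vertex [a] of [X] from the corona of [X]
    and [H] leaves the copy of [H] at [a] alone, while the link of [a] loses this copy.  If
    [H] has an edge, its regularity is at least 1, so the bound is the one for the disjoint
    copies of [H] ([reg_le_corona_pos]).  If [H] has no edge, the copies contribute 0 and
    each vertex of [X] at most 1; for a star, the centre contributes nothing.  Lower bounds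
    come from induced subgraphs, namely the copies of [H] or the edges joining each leaf of
    the star to a vertex of its copy, and from the fact that products of nonzero cohomology
    classes in a join are nonzero ([join_nonacyclic]).

    For Hochster's formula, [Tor_i(S/I, K)] is computed from the Koszul complex, whose
    component in each multidegree is the cochain complex of a family of sets: a cone
    unless the multidegree is squarefree, and the restriction to [W] in the multidegree of
    the product of [W] ([koszul_bounds]).  On the other hand, shifting dimensions along a
    minimal resolution turns [Tor_i(S/I, K)] into [Tor_0] of the [i]-th syzygies, which is
    spanned by the generators of the [i]-th free module ([fdeg_tor]).  The same shift
    yields the existence of minimal resolutions: it shows that syzygies are generated in
    degrees at most the number of variables, hence by finitely many elements, and a
    smallest set of homogeneous generators has no relation with a constant coefficient
    ([minimal_generators]). *)

Set Implicit Arguments.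
Unset Strict Implicit.
Unset Printing Implicit Defensive.
Import Order.TTheory GRing.Theory Num.Theory.
Local Open Scope ring_scope.

Lemma prop_choice (A B : Type) (R : A -> B -> Prop) :
  (forall a, exists b, R a b) -> exists f, forall a, R a (f a).
Proof.
move=> h; exists (fun a => proj1_sig (constructive_indefinite_description _ (h a))) => a.
exact: (proj2_sig (constructive_indefinite_description _ (h a))).
Qed.

(** * Cochains of families of finite sets *)

Section Cochains.
Variables (K : fieldType) (V : finType).
Implicit Types (e : V -> {set V} -> K) (b c : {set V} -> K) (D : pred {set V}).
Implicit Types (s t U W : {set V}) (u v x : V).

(** Incidence signs are kept abstract: the anticommutation rule is all that makes
    [cobd] a differential, and joins and Koszul complexes come with signs of their
    own that are not the alternating ones. *)
Definition sign_system e : Prop :=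
  (forall v t, e v t * e v t = 1) /\
  (forall t u v, u \in t -> v \in t -> u != v ->
     e v t * e u (t :\ v) = - (e u t * e v (t :\ u))).

Definition cobd e c t : K := \sum_(v in t) e v t * c (t :\ v).

(** The reduced cohomology of the family [D] vanishes on faces with [r] vertices,
    that is, in simplicial dimension [r - 1].  Cochains are functions on all sets, and
    they are compared on [D] only. *)
Definition acyclic_at e D r : Prop :=
  forall c, (forall t, D t -> #|t| = r.+1 -> cobd e c t = 0) ->
  exists b, forall t, D t -> #|t| = r -> c t = cobd e b t.

Definition down_closed D : Prop := forall s t, s \subset t -> D t -> D s.

(** The terms of [(u, v)] and [(v, u)] cancel; splitting by an order on [V] pairs
    them off also in characteristic 2. *)
Lemma sum_antisym (W0 : zmodType) (F : V -> V -> W0) t :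
    (forall u v, u \in t -> v \in t -> u != v -> F v u = - F u v) ->
  \sum_(v in t) \sum_(u in t :\ v) F v u = 0.
Proof.
move=> FN; pose lt u v := (enum_rank u < enum_rank v)%N.
have -> : \sum_(v in t) \sum_(u in t :\ v) F v u =
    \sum_(v in t) \sum_(u in t | lt u v) F v u
  + \sum_(v in t) \sum_(u in t | lt v u) F v u.
  rewrite -big_split; apply: eq_bigr => v vt /=.
  rewrite (bigID (fun u => lt u v)) /=.
  congr (_ + _); apply: eq_bigl => u; rewrite in_setD1 /lt.
    by case: (eqVneq u v) => [->|//]; rewrite ltnn !andbF.
  rewrite -leqNgt leq_eqVlt; case: (eqVneq u v) => [->|uv] /=.
    by rewrite ltnn andbF.
  by rewrite (inj_eq val_inj) (inj_eq enum_rank_inj) eq_sym (negPf uv).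
rewrite [X in _ + X](exchange_big_dep (mem t)) /=; last by move=> v u _ /andP[].
rewrite -big_split big1 //= => v vt.
rewrite [X in _ + X](eq_bigl (fun u => (u \in t) && lt u v)); last first.
  by move=> u; rewrite vt.
rewrite -big_split big1 //= => u /andP[ut ltuv].
rewrite FN ?addNr //; apply: contraTneq ltuv => ->; by rewrite /lt ltnn.
Qed.

Lemma cobdK e c t : sign_system e -> cobd e (cobd e c) t = 0.
Proof.
move=> [_ eN]; rewrite /cobd.
under eq_bigr do rewrite mulr_sumr.
apply: sum_antisym => u v ut vt uv.
by rewrite !mulrA eN // mulNr setDDl setUC -setDDl.
Qed.

Lemma cobdB e b c t : cobd e (fun s => b s - c s) t = cobd e b t - cobd e c t.
Proof. by rewrite /cobd -sumrB; apply: eq_bigr => v _; rewrite mulrBr. Qed.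

Lemma cobdD e b c t : cobd e (fun s => b s + c s) t = cobd e b t + cobd e c t.
Proof. by rewrite /cobd -big_split; apply: eq_bigr => v _; rewrite mulrDr. Qed.

Lemma eq_acyclic_at e D D' r : D =1 D' -> acyclic_at e D r -> acyclic_at e D' r.
Proof.
move=> DD' ac c cz; have [|b bP] := ac c.
  by move=> t; rewrite DD'; apply: cz.
by exists b => t; rewrite -DD'; apply: bP.
Qed.

Lemma sign_neq0 e v t : sign_system e -> e v t != 0.
Proof.
by move=> [e2 _]; apply: contra_eq_neq (e2 v t) => ->; rewrite mul0r eq_sym oner_neq0.
Qed.

(** The ratio of two systems of signs is a 1-cocycle on the cube of all subsets,
    and the cube is simply connected: the ratio is the coboundary of the function [g]
    that multiplies the ratios met when the vertices of a set are removed one by one. *)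
Lemma sign_gauge e e' : sign_system e -> sign_system e' ->
  exists2 g : {set V} -> K, (forall t, g t != 0) &
    forall c t, cobd e' c t = g t * cobd e (fun s => (g s)^-1 * c s) t.
Proof.
move=> he he'; have [e2 eN] := he; have [e2' eN'] := he'.
pose rho v t := e' v t * e v t.
have rhoC t u v : u \in t -> v \in t -> u != v ->
    rho v t * rho u (t :\ v) = rho u t * rho v (t :\ u).
  move=> ut vt uv; rewrite /rho mulrACA eN' // eN // mulrNN.
  by rewrite mulrACA.
pose fix g (k : nat) t {struct k} : K := if k is k'.+1 then
   if [pick v in t] is Some v then rho v t * g k' (t :\ v) else 1 else 1.
have gP k t v : #|t| = k -> v \in t -> g k t = rho v t * g k.-1 (t :\ v).
  elim: k t v => [|k IH] t v /=; first by move/cards0_eq->; rewrite inE.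
  move=> tk vt; case: pickP => [u ut|/(_ v)]; last by rewrite vt.
  case: (eqVneq u v) => [->//|uv].
  have cu w : w \in t -> #|t :\ w| = k.
    by move=> wt; move: tk; rewrite (cardsD1 w) wt => -[].
  rewrite (IH (t :\ u) v) ?cu ?in_setD1 1?eq_sym ?uv //.
  rewrite (IH (t :\ v) u) ?cu ?in_setD1 ?uv //.
  by rewrite [LHS]mulrA [RHS]mulrA (rhoC t v u) 1?eq_sym // setDDl setUC -setDDl.
have gn0 k t : g k t != 0.
  elim: k t => [|k IH] t /=; first exact: oner_neq0.
  case: pickP => [v _|_]; last exact: oner_neq0.
  by rewrite mulf_neq0 // /rho mulf_neq0 // sign_neq0.
exists (fun t => g #|t| t) => // c t; rewrite /cobd mulr_sumr.
apply: eq_bigr => v vt; rewrite (gP _ t v) //.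
have -> : #|t|.-1 = #|t :\ v| by rewrite (cardsD1 v) vt.
have -> : e' v t = rho v t * e v t by rewrite /rho -mulrA e2 mulr1.
by rewrite [RHS]mulrACA mulVKf.
Qed.

Lemma acyclic_at_sign e e' D r : sign_system e -> sign_system e' ->
  acyclic_at e D r -> acyclic_at e' D r.
Proof.
move=> he he' ac c cz; have [g g0 gE] := sign_gauge he he'.
have [|b bP] := ac (fun s => (g s)^-1 * c s).
  move=> t Dt tr; apply: (mulfI (g0 t)); rewrite -gE mulr0; exact: cz.
exists (fun s => g s * b s) => t Dt tr.
rewrite gE; apply: (mulfI (invr_neq0 (g0 t))); rewrite bP // mulKf //.
by apply: eq_bigr => v _; rewrite mulKf.
Qed.

(** A cone is contracted to its apex [x]. *)
Lemma acyclic_at_cone e D x r : sign_system e -> (forall t, D t -> D (x |: t)) ->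
  acyclic_at e D r.
Proof.
move=> he Dx c cz; have [e2 eN] := he.
exists (fun t => if x \in t then 0 else e x (x |: t) * c (x |: t)) => t Dt tr.
have [xt|xt] := boolP (x \in t).
  rewrite /cobd (bigD1 x) //= setD11 setD1K // mulrA e2 mul1r big1 ?addr0 //.
  by move=> v /andP[vt vx]; rewrite in_setD1 eq_sym vx xt mulr0.
have := cz _ (Dx _ Dt); rewrite cardsU1 xt tr => /(_ erefl).
rewrite /cobd big_setU1 //= setU1K // => /eqP; rewrite addr_eq0.
move=> /eqP/(congr1 (GRing.mul (e x (x |: t)))); rewrite mulrA e2 mul1r => ->.
rewrite mulrN mulr_sumr -sumrN; apply: eq_bigr => v vt.
have vx : v != x by apply: contraNneq xt => <-.
rewrite in_setD1 (negPf xt) andbF.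
have -> : x |: t :\ v = (x |: t) :\ v.
  by apply/setP=> y; rewrite !inE; case: eqP => [->|//]; rewrite eq_sym vx.
have key : e v t * e x ((x |: t) :\ v) = - (e x (x |: t) * e v (x |: t)).
  have := eN (x |: t) v x (setU1r _ vt) (setU11 _ _) vx; rewrite setU1K //.
  move=> AB; rewrite -[e v t]mul1r -(e2 x (x |: t)) -(mulrA (e x _)) AB.
  by rewrite mulrN mulNr -!mulrA e2 mulr1.
by rewrite [RHS]mulrA key mulNr -mulrA.
Qed.

(** The exact sequence of the deletion and the link of [x], on cochains: a cocycle
    is first corrected by a coboundary of the deletion so that it is supported on the
    faces containing [x]; there it is a cocycle of the link, one vertex smaller. *)
Lemma acyclic_at_del_link e D x r : sign_system e -> down_closed D ->
    acyclic_at e [pred t | D t && (x \notin t)] r.+1 ->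
    acyclic_at e [pred t | D (x |: t) && (x \notin t)] r ->
  acyclic_at e D r.+1.
Proof.
move=> he Dd acd acl c cz; have [e2 eN] := he.
have [|b0 b0P] := acd c; first by move=> t /andP[/cz+ _].
(* This cocycle vanishes on the faces that do not contain [x]. *)
pose c1 t := c t - cobd e b0 t.
have c1z t : D t -> #|t| = r.+2 -> cobd e c1 t = 0.
  by move=> Dt tr; rewrite cobdB cz // cobdK // subr0.
have c1x t : D t -> x \notin t -> #|t| = r.+1 -> c1 t = 0.
  by move=> Dt xt tr; rewrite /c1 -b0P ?subrr //= Dt.
have swap t v : x \notin t -> v \in t ->
    [/\ (x |: t) :\ v = x |: (t :\ v), x \notin t :\ v &
     e v (x |: t) * e x (x |: (t :\ v)) = - (e x (x |: t) * e v t)].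
  move=> xt vt; have vx : v != x by apply: contraNneq xt => <-.
  have E : (x |: t) :\ v = x |: (t :\ v).
    by apply/setP=> y; rewrite !inE; case: (eqVneq y x) => [->|//]; rewrite eq_sym vx.
  split => //; first by rewrite in_setD1 (negPf xt) andbF.
  rewrite -E eN ?setU11 ?setU1r //; first by rewrite setU1K.
  by rewrite eq_sym.
(* The cocycle [c1] read on the link of [x]. *)
pose f t := e x (x |: t) * c1 (x |: t).
have [|b1 b1P] := acl f.
  move=> t /= /andP[Dxt xt] tr.
  have := c1z _ Dxt; rewrite cardsU1 xt tr => /(_ erefl).
  rewrite /cobd big_setU1 //= setU1K // c1x //; last exact: Dd (subsetUr _ _) Dxt.
  rewrite mulr0 add0r => s0; apply: (mulfI (sign_neq0 x (x |: t) he)).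
  rewrite mulr0; apply/eqP; rewrite -oppr_eq0 mulr_sumr -sumrN; apply/eqP; rewrite -[RHS]s0.
  apply: eq_bigr => v vt; have [E xtv sw] := swap t v xt vt.
  rewrite /f E [e x _ * (e v t * _)]mulrA -mulNr -sw -mulrA.
  by rewrite (mulrA (e x _)) e2 mul1r.
pose b2 t := if x \in t then - (e x t * b1 (t :\ x)) else 0.
exists (fun t => b0 t + b2 t) => t Dt tr; rewrite cobdD; apply/eqP.
rewrite addrC -subr_eq -/(c1 t); apply/eqP.
have [xt|xt] := boolP (x \in t); last first.
  rewrite c1x // /cobd big1 // => v vt.
  by rewrite /b2 in_setD1 (negPf xt) andbF mulr0.
have tE : t = x |: (t :\ x) by rewrite setD1K.
have xs : x \notin t :\ x by rewrite setD11.
move: (t :\ x) tE xs => s tE xs; subst t.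
have sr : #|s| = r by move: tr; rewrite cardsU1 xs => -[].
have := b1P s; rewrite /= Dt xs => /(_ isT sr); rewrite /f.
move=> /(congr1 (GRing.mul (e x (x |: s)))); rewrite mulrA e2 mul1r => ->.
rewrite /cobd big_setU1 //= setU1K // {1}/b2 (negPf xs) mulr0 add0r mulr_sumr.
apply: eq_bigr => v vs; have [E xsv sw] := swap s v xs vs.
by rewrite E /b2 setU11 setU1K // mulrN !mulrA sw mulNr opprK.
Qed.

End Cochains.

(** * Contracting homotopies and dual cycles *)

(** Over a field, the solutions of a linear system can be chosen to depend linearly
    on the right-hand side.  The Kuenneth formula rests on this: over a ring there would
    be a torsion term. *)
Lemma linear_solve (K : fieldType) (A B : finType) (M : A -> B -> K) :
  exists P : B -> A -> K, forall c : B -> K,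
    (exists b : A -> K, forall t, c t = \sum_a b a * M a t) ->
  forall t, c t = \sum_a (\sum_s c s * P s a) * M a t.
Proof.
pose m := \matrix_(i < #|A|, j < #|B|) M (enum_val i) (enum_val j).
exists (fun s a => pinvmx m (enum_rank s) (enum_rank a)) => c [b bP] t.
have sum_val (T : finType) (F : T -> K) : \sum_x F x = \sum_(i < #|T|) F (enum_val i).
  by rewrite (reindex (@enum_val _ T)) //; apply/onW_bij/enum_val_bij.
pose rc : 'rV_#|B| := \row_j c (enum_val j).
have rcm : (rc <= m)%MS.
  apply/submxP; exists (\row_i b (enum_val i)); apply/rowP=> j.
  by rewrite !mxE bP (sum_val A); apply: eq_bigr => i _; rewrite !mxE.
have /rowP/(_ (enum_rank t)) := mulmxKpV rcm; rewrite !mxE enum_rankK => <-.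
rewrite (sum_val A); apply: eq_bigr => i _; rewrite !mxE enum_rankK; congr (_ * _).
by rewrite (sum_val B); apply: eq_bigr => j _; rewrite !mxE !enum_valK.
Qed.

Section Linear.
Variables (K : fieldType) (V : finType).
Implicit Types (e : V -> {set V} -> K) (b c : {set V} -> K) (D : pred {set V}).
Implicit Types (s t U W : {set V}) (u v x : V).

Lemma eq_cobd e b c t : (forall v, v \in t -> b (t :\ v) = c (t :\ v)) ->
  cobd e b t = cobd e c t.
Proof. by move=> bc; apply: eq_bigr => v /bc->. Qed.

(** The matrix of the coboundary from faces with [r - 1] vertices to faces with
    [r] vertices. *)
Definition cobd_coef e D r s t : K :=
  if D t && (#|t| == r) then \sum_(v in t) (s == t :\ v)%:R * e v t else 0.

Lemma sum_cobd_coef e D r b t :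
  \sum_s b s * cobd_coef e D r s t = if D t && (#|t| == r) then cobd e b t else 0.
Proof.
rewrite /cobd_coef; case: ifP => _; last by rewrite big1 // => s _; rewrite mulr0.
under eq_bigr do rewrite mulr_sumr.
rewrite exchange_big; apply: eq_bigr => v _ /=.
rewrite (bigD1 (t :\ v)) //= eqxx mul1r mulrC big1 ?addr0 // => s /negPf->.
by rewrite mul0r mulr0.
Qed.

Definition linear_on_cochains (H : ({set V} -> K) -> {set V} -> K) : Prop :=
  forall k c d t, H (fun s => k * c s + d s) t = k * H c t + H d t.

(** Identities between cochains hold on [D] only, so that an operator may be applied
    to them only if its value at [t] looks at no other sets. *)
Definition local_on D (H : ({set V} -> K) -> {set V} -> K) : Prop :=
  forall c d t, (forall s, D s -> #|s| = #|t|.+1 -> c s = d s) -> H c t = H d t.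

Definition contraction e D R H : Prop :=
  [/\ linear_on_cochains H, local_on D H &
   forall c t, D t -> (R < #|t|)%N -> c t = cobd e (H c) t + H (cobd e c) t].

(** If [h] solves [cobd (h c) = c] linearly for all cocycles [c] of large degree, then
    [c - h (cobd c)] is a cocycle for every [c], and [c |-> h (c - h (cobd c))] is a
    contracting homotopy. *)
Lemma exists_contraction e D R : sign_system e -> down_closed D ->
  (forall r, (R < r)%N -> acyclic_at e D r) -> exists H, contraction e D R H.
Proof.
move=> he Dd ac.
have [P PP] := prop_choice (fun a => linear_solve (cobd_coef e D a)).
pose res a c s := if D s && (#|s| == a) then c s else 0.
pose h a c s := \sum_t res a c t * P a t s.
have hlin a k c d t : h a (fun s => k * c s + d s) t = k * h a c t + h a d t.
  rewrite /h mulr_sumr -big_split; apply: eq_bigr => s _ /=.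
  by rewrite /res; case: ifP => _; rewrite ?mul0r ?mulr0 ?addr0 // mulrDl mulrA.
have hloc a c d t : (forall s, D s -> #|s| = a -> c s = d s) -> h a c t = h a d t.
  move=> cd; apply: eq_bigr => s _; rewrite /res.
  by case: ifP => // /andP[Ds /eqP sa]; rewrite cd.
have hsol a c : (R < a)%N -> (forall s, D s -> #|s| = a.+1 -> cobd e c s = 0) ->
    forall t, D t -> #|t| = a -> c t = cobd e (h a c) t.
  move=> Ra cz t Dt ta; have [b bP] := ac a Ra c cz; 
  have resE s : res a c s = \sum_u b u * cobd_coef e D a u s.
    rewrite sum_cobd_coef /res; case: ifP => // /andP[Ds /eqP sa]; exact: bP.
  have := PP a _ (ex_intro _ b resE) t.
  by rewrite sum_cobd_coef /res Dt ta eqxx.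
pose H c t := if (R <= #|t|)%N then
  h #|t|.+1 (fun s => c s - h #|t|.+2 (cobd e c) s) t else 0.
exists H; rewrite /H; split.
- move=> k c d t; case: ifP => _; last by rewrite mulr0 addr0.
  rewrite -hlin; apply: (hloc) => s Ds st.
  have -> : h #|t|.+2 (cobd e (fun s => k * c s + d s)) s =
      k * h #|t|.+2 (cobd e c) s + h #|t|.+2 (cobd e d) s.
    rewrite -hlin; apply: (hloc) => u Du us.
    rewrite /cobd mulr_sumr -big_split; apply: eq_bigr => v _ /=.
    by rewrite mulrDr mulrCA.
  by ring.
- move=> c d t cd; case: ifP => // _; apply: (hloc) => s Ds st; rewrite cd //.
  congr (_ - _); apply: (hloc) => u Du us; apply: eq_cobd => v vu; apply: cd.
    exact: Dd (subsetDl _ _) Du.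
  by move: us; rewrite (cardsD1 v) vu => -[].
move=> c t Dt Rt; rewrite -/(H c) -/(H _ t).
pose c' s := c s - h #|t|.+1 (cobd e c) s.
have cobdH : cobd e (H c) t = cobd e (h #|t| c') t.
  apply: eq_cobd => v vt; have tv : #|t| = #|t :\ v|.+1 by rewrite (cardsD1 v) vt.
  by rewrite /H -ltnS -tv Rt.
rewrite cobdH -hsol //; last first.
  move=> s Ds st; rewrite cobdB.
  by rewrite -(hsol _ (cobd e c) (leqW Rt) (fun w _ _ => cobdK c w he) s Ds st) subrr.
rewrite /H ltnW // /c'.
rewrite [X in _ + X](hloc _ _ (cobd e c)) ?subrK // => s Ds st.
rewrite (hloc _ _ (fun=> 0)); last by move=> u _ _; rewrite cobdK.
rewrite {1}/h big1 ?subr0 // => u _.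
by rewrite /res; case: ifP; rewrite mul0r.
Qed.

(** A cocycle that is not a coboundary is detected by a cycle [z], because the
    coboundaries are the annihilator of the cycles. *)
Lemma nonacyclic_functional e D r : ~ acyclic_at e D r ->
  exists c z, [/\ forall t, D t -> #|t| = r.+1 -> cobd e c t = 0,
    forall t, ~~ (D t && (#|t| == r)) -> z t = 0,
    forall b, \sum_t z t * cobd e b t = 0 &
    \sum_t z t * c t = 1].
Proof.
move=> nac; have [P PP] := linear_solve (cobd_coef e D r).
have [c nc] := not_all_ex_not _ _ nac.
have [cz nb] := imply_to_and _ _ nc.
pose res c t := if D t && (#|t| == r) then c t else 0.
pose def c t := c t - \sum_a (\sum_s res c s * P s a) * cobd_coef e D r a t.
have [[t [/andP[Dt tr] ct]]|/not_ex_all_not none] :=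
    classic (exists t, D t && (#|t| == r) /\ def c t <> 0); last first.
  case: nb; exists (fun a => \sum_s res c s * P s a) => t Dt tr.
  have := none t; rewrite Dt tr eqxx /def => /not_and_or[//|/NNPP/eqP].
  by rewrite subr_eq0 sum_cobd_coef Dt tr eqxx => /eqP.
(* The functional that evaluates at [t] the defect of the best linear solution. *)
pose z s := if D s && (#|s| == r) then
   (s == t)%:R - \sum_a P s a * cobd_coef e D r a t else 0.
have zE d : \sum_s z s * d s = def d t.
  rewrite /def -[d t]mul1r.
  have -> : \sum_s z s * d s = \sum_s ((s == t)%:R * d s
      - \sum_a res d s * P s a * cobd_coef e D r a t).
    apply: eq_bigr => s _; rewrite /z /res; case: ifP => [_|Ds].
      rewrite mulrBl mulr_suml; congr (_ - _).
      by apply: eq_bigr => a _; rewrite mulrC mulrA.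
    rewrite mul0r big1 ?subr0; last by move=> a _; rewrite !mul0r.
    case: eqP => [st|_]; last by rewrite mul0r.
    by rewrite st Dt tr in Ds.
  rewrite sumrB (bigD1 t) //= eqxx big1 ?addr0; last by move=> s /negPf->; rewrite mul0r.
  congr (_ - _); rewrite exchange_big; apply: eq_bigr => a _ /=.
  by rewrite mulr_suml.
exists c, (fun s => (def c t)^-1 * z s); split => //.
- by move=> s /negPf Ds; rewrite /z Ds mulr0.
- move=> b; under eq_bigr do rewrite -mulrA.
  rewrite -mulr_sumr zE /def.
  have resE s : res (cobd e b) s = \sum_u b u * cobd_coef e D r u s.
    by rewrite sum_cobd_coef.
  have <- := PP _ (ex_intro _ b resE) t.
  by rewrite /res Dt tr subrr mulr0.
- under eq_bigr do rewrite -mulrA.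
  by rewrite -mulr_sumr zE mulVf //; apply/eqP.
Qed.

End Linear.

(** * The Kuenneth formula for joins *)

Section Join.
Variables (K : fieldType) (V : finType).
Implicit Types (e : V -> {set V} -> K) (b c : {set V} -> K) (D : pred {set V}).
Implicit Types (s t U W : {set V}) (u v x : V).

(** The faces of the join of a family on [U] with a family on the complement of
    [U]. *)
Definition join U D1 D2 : pred {set V} := [pred t | D1 (t :&: U) && D2 (t :\: U)].

(** The signs of a tensor product of complexes. *)
Definition join_sign e U v t : K :=
  if v \in U then e v (t :&: U) else (-1) ^+ #|t :&: U| * e v (t :\: U).

Lemma join_sign_system e U : sign_system e -> sign_system (join_sign e U).
Proof.
move=> [e2 eN]; split=> [v t|t u v ut vt uv]; rewrite /join_sign.
  by case: ifP => _ //; rewrite mulrACA e2 mulr1 -expr2 sqrr_sign.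
have I1 x : (t :\ x) :&: U = (t :&: U) :\ x by rewrite setIDAC.
have D1 x : (t :\ x) :\: U = (t :\: U) :\ x by rewrite setDDl setUC -setDDl.
have I0 x : x \notin U -> (t :&: U) :\ x = t :&: U.
  move=> xU; apply/setP=> y; rewrite !inE; case: eqP => // ->.
  by rewrite (negPf xU) andbF.
have D0 x : x \in U -> (t :\: U) :\ x = t :\: U.
  by move=> xU; apply/setP=> y; rewrite !inE; case: eqP => // ->; rewrite xU.
rewrite !I1 !D1; case: ifP => vU; case: ifP => uU.
- by rewrite eN // inE ?ut ?vt ?uU ?vU.
- rewrite (I0 u) ?uU // (D0 v) //.
  by rewrite (cardsD1 v (t :&: U)) inE vt vU exprS; ring.
- rewrite (I0 v) ?vU // (D0 u) //.
  by rewrite (cardsD1 u (t :&: U)) inE ut uU exprS; ring.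
- have := eN (t :\: U) u v; rewrite !inE ut vt uU vU => /(_ isT isT uv) E.
  rewrite (I0 u) ?uU // (I0 v) ?vU //.
  by rewrite mulrACA E [in RHS]mulrACA mulrN.
Qed.

Lemma split_union U t1 t2 : t1 \subset U -> t2 \subset ~: U ->
  [/\ (t1 :|: t2) :&: U = t1, (t1 :|: t2) :\: U = t2 &
      #|t1 :|: t2| = (#|t1| + #|t2|)%N].
Proof.
move=> s1; rewrite -disjoints_subset => s2; have s2' := s2.
have t2U : t2 :&: U = set0 by apply/eqP; rewrite setI_eq0.
split.
- by rewrite setIUl t2U setU0; apply/setIidPl.
- rewrite setDUl (eqP (_ : t1 :\: U == set0)) ?setD_eq0 // set0U.
  by apply/setDidPl.
- rewrite cardsU [t1 :&: t2](_ : _ = set0) ?cards0 ?subn0 //.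
  by apply/eqP; rewrite -subset0 -t2U setIC setIS.
Qed.

Lemma cobd_join e c U t1 t2 : t1 \subset U -> t2 \subset ~: U ->
  cobd (join_sign e U) c (t1 :|: t2) =
    cobd e (fun s => c (s :|: t2)) t1 +
    (-1) ^+ #|t1| * cobd e (fun s => c (t1 :|: s)) t2.
Proof.
move=> s1 s2; have [E1 E2 _] := split_union s1 s2.
rewrite /cobd (big_setID U) /= E1 E2 mulr_sumr; congr (_ + _); apply: eq_bigr => v vt.
  have vU := subsetP s1 _ vt; rewrite /join_sign vU E1; congr (_ * c _).
  rewrite setDUl; congr (_ :|: _); apply/setP=> y; rewrite !inE.
  by case: eqP => // ->; apply/esym/negbTE; apply: contraL vU => /(subsetP s2); rewrite inE.
have := subsetP s2 _ vt; rewrite inE => vU.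
rewrite /join_sign (negPf vU) E1 E2 mulrA; congr (_ * c _).
rewrite setDUl; congr (_ :|: _); apply/setP=> y; rewrite !inE.
by case: eqP => // ->; apply/esym/negbTE; apply: contra vU => /(subsetP s1).
Qed.

Lemma linear0 (H : ({set V} -> K) -> {set V} -> K) t :
  linear_on_cochains H -> H (fun=> 0) t = 0.
Proof.
move=> Hlin; have := Hlin 1 (fun=> 0) (fun=> 0) t.
have -> : (fun s : {set V} => 1 * (fun=> 0) s + (fun=> 0) s) = (fun=> 0) :> (_ -> K).
  by apply: functional_extensionality => s; rewrite mulr0 addr0.
by rewrite mul1r -{1}[H _ t]addr0 => /addrI.
Qed.

Lemma linear_sum (H : ({set V} -> K) -> {set V} -> K) (I : finType) (P : {pred I})
    (k : I -> K) (d : I -> {set V} -> K) t : linear_on_cochains H ->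
  H (fun s => \sum_(i in P) k i * d i s) t = \sum_(i in P) k i * H (d i) t.
Proof.
move=> Hlin; have eqH c c' : c =1 c' -> H c t = H c' t.
  by move=> /functional_extensionality->.
rewrite -[RHS]big_enum /= (eqH _ (fun s => \sum_(i <- enum P) k i * d i s)); last first.
  by move=> s; rewrite big_enum.
elim: (enum P) => [|i r IH].
  by rewrite big_nil -[RHS](linear0 t Hlin); apply: eqH => s; rewrite big_nil.
rewrite big_cons -IH -(Hlin (k i) (d i) _ t); apply: eqH => s; by rewrite big_cons.
Qed.

(** The homotopy of the first factor is applied to each slice [c (_ :|: t2)] of a
    cocycle [c].  By the choice of signs it anticommutes with the coboundary of the second
    factor, so that [cobd b + H (cobd c)] is computed slice by slice.  Hence [b] cobounds
    [c] where the part of the face in [U] is large, and creates nothing in slices where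
    [c] vanishes. *)
Lemma join_half e U D1 D2 R H c r : down_closed D1 ->
    (forall t, D1 t -> t \subset U) -> (forall t, D2 t -> t \subset ~: U) ->
    contraction e D1 R H ->
    (forall t, join U D1 D2 t -> #|t| = r.+1 -> cobd (join_sign e U) c t = 0) ->
  exists b, forall t, join U D1 D2 t -> #|t| = r ->
    ((R < #|t :&: U|)%N -> c t = cobd (join_sign e U) b t) /\
    ((forall s, D1 s -> #|s| = #|t :&: U| -> c (s :|: (t :\: U)) = 0) ->
       cobd (join_sign e U) b t = 0).
Proof.
move=> D1d D1U D2U [Hlin Hloc Hhom] cz.
exists (fun t => H (fun s => c (s :|: (t :\: U))) (t :&: U)) => t /andP[].
move: (t :&: U) (t :\: U) (setID t U) => t1 t2 <- {t} D1t D2t tr.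
have s1 := D1U _ D1t; have s2 := D2U _ D2t; have [_ _ ct] := split_union s1 s2.
set ct2 := fun s => c (s :|: t2).
(* Only the homotopy and the coboundary of the first factor remain. *)
have core : cobd (join_sign e U) (fun t => H (fun s => c (s :|: (t :\: U))) (t :&: U))
    (t1 :|: t2) = cobd e (H ct2) t1 + H (cobd e ct2) t1.
  rewrite cobd_join //; congr (_ + _).
    apply: eq_cobd => v vt.
    have sv : t1 :\ v \subset U by apply: subset_trans s1; apply: subsetDl.
    by have [-> -> _] := split_union sv s2.
  transitivity (\sum_(v in t2) (-1) ^+ #|t1| * e v t2 * H (fun s => c (s :|: (t2 :\ v))) t1).
    rewrite mulr_sumr; apply: eq_bigr => v vt; rewrite mulrA; congr (_ * _).
    have sv : t2 :\ v \subset ~: U by apply: subset_trans s2; apply: subsetDl.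
    by have [-> -> _] := split_union s1 sv.
  rewrite -linear_sum //; apply: (Hloc) => s D1s st1.
  have sU := D1U _ D1s.
  have := cz (s :|: t2); rewrite /join /= cobd_join //.
  have [-> -> ->] := split_union sU s2; rewrite D1s D2t st1 addSn -ct tr.
  move=> /(_ isT erefl)/eqP; rewrite addrC addr_eq0 exprS mulN1r mulNr eqr_opp => /eqP <-.
  by rewrite mulr_sumr; apply: eq_bigr => v _; rewrite mulrA.
rewrite core; split=> [Rt|c0]; first by rewrite -Hhom.
have H0 s := linear0 s Hlin.
rewrite (Hloc (cobd e ct2) (fun=> 0)) ?H0 ?addr0; last first.
  move=> s D1s st1; rewrite /cobd big1 // => v vs; rewrite /ct2 c0 ?mulr0 //.
    by apply: D1d D1s; apply: subsetDl.
  by move: st1; rewrite (cardsD1 v) vs => -[].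
rewrite /cobd big1 // => v vt; rewrite (Hloc _ (fun=> 0)) ?H0 ?mulr0 // => s D1s st.
by apply: c0 => //; rewrite st (cardsD1 v t1) vt.
Qed.

Lemma joinC U D1 D2 : join U D1 D2 =1 join (~: U) D2 D1.
Proof. by move=> t; rewrite /join /= setDE [t :\: ~: U]setDE setCK andbC. Qed.

(** A first homotopy removes the components of a cocycle whose part in [U] has more
    than [R1] vertices.  In the others the part outside [U] has more than [R2] vertices, so
    that the homotopy of the second factor removes them all; it does not bring back the
    first ones because it acts on slices. *)
Lemma join_acyclic e U D1 D2 R1 R2 r : sign_system e ->
    down_closed D1 -> down_closed D2 ->
    (forall t, D1 t -> t \subset U) -> (forall t, D2 t -> t \subset ~: U) ->
    (forall r, (R1 < r)%N -> acyclic_at e D1 r) ->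
    (forall r, (R2 < r)%N -> acyclic_at e D2 r) ->
  (R1 + R2 < r)%N -> acyclic_at e (join U D1 D2) r.
Proof.
move=> he d1 d2 s1 s2 ac1 ac2 Rr.
have hs := join_sign_system U he; have hs' := join_sign_system (~: U) he.
apply: (acyclic_at_sign hs he) => c cz.
have [H1 con1] := exists_contraction he d1 ac1.
have [H2 con2] := exists_contraction he d2 ac2.
have [b1 b1P] := join_half d1 s1 s2 con1 cz.
pose c' t := c t - cobd (join_sign e U) b1 t.
have c'z t : join U D1 D2 t -> #|t| = r.+1 -> cobd (join_sign e U) c' t = 0.
  by move=> Dt tr; rewrite cobdB cz // cobdK // subr0.
have c'0 t : join U D1 D2 t -> #|t| = r -> (R1 < #|t :&: U|)%N -> c' t = 0.
  by move=> Dt tr Rt; rewrite /c' -(b1P t Dt tr).1 // subrr.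
have [g g0 gE] := sign_gauge hs' hs.
pose c2 t := (g t)^-1 * c' t.
have s1' t : D1 t -> t \subset ~: ~: U by rewrite setCK; apply: s1.
have [|b2 b2P] := join_half (c := c2) (r := r) d2 s2 s1' con2.
  move=> t; rewrite -joinC => Dt tr; apply: (mulfI (g0 t)).
  by rewrite -gE mulr0 c'z.
exists (fun t => b1 t + g t * b2 t) => t Dt tr; rewrite cobdD.
apply/eqP; rewrite addrC -subr_eq -/(c' t) gE; apply/eqP.
(* The two halves use different signs; the function [g] translates between them. *)
have -> : cobd (join_sign e (~: U)) (fun s => (g s)^-1 * (g s * b2 s)) t =
    cobd (join_sign e (~: U)) b2 t by apply: eq_cobd => v _; rewrite mulKf.
have Dt' := Dt; rewrite joinC in Dt'.
have [b2t b2t0] := b2P t Dt' tr.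
have c2E : c' t = g t * c2 t by rewrite /c2 mulVKf.
rewrite c2E; congr (_ * _); case: (ltnP R2 #|t :&: ~: U|) => [/b2t //|tR2].
have card2 (s : {set V}) : (#|s :&: U| + #|s :&: ~: U|)%N = #|s|.
  by rewrite -setDE cardsID.
have tR1 : (R1 < #|t :&: U|)%N by have := card2 t; lia.
rewrite b2t0 => [|s D2s st].
  by rewrite /c2 c'0 ?mulr0.
have tU : t :\: ~: U = t :&: U by rewrite setDE setCK.
have [E1 E2 E3] := split_union (subsetIr t U) (s2 _ D2s).
rewrite tU setUC in E1 E2 E3 *.
rewrite /c2 c'0 ?mulr0 ?E1 //.
- by rewrite /join /= E1 E2 D2s; case/andP: Dt => ->.
- by rewrite E3 st card2.
Qed.

(** The product of two cocycles that do not cobound is a cocycle.  If it were a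
    coboundary, pairing its first factor with a dual cycle would exhibit the second factor
    as a coboundary. *)
Lemma join_nonacyclic e U D1 D2 r1 r2 : sign_system e ->
    (forall t, D1 t -> t \subset U) -> (forall t, D2 t -> t \subset ~: U) ->
    ~ acyclic_at e D1 r1 -> ~ acyclic_at e D2 r2 ->
  ~ acyclic_at e (join U D1 D2) (r1 + r2).
Proof.
move=> he s1 s2 /nonacyclic_functional[c1 [z [c1z zD zB zc1]]] nac2 ac; apply: nac2.
have hs := join_sign_system U he.
have {}ac := acyclic_at_sign he hs ac.
move=> c2 c2z.
pose c t := (if #|t :&: U| == r1 then c1 (t :&: U) else 0) * c2 (t :\: U).
have cE t1 t2 : t1 \subset U -> t2 \subset ~: U ->
    c (t1 :|: t2) = (if #|t1| == r1 then c1 t1 else 0) * c2 t2.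
  by move=> t1U t2U; rewrite /c; have [-> -> _] := split_union t1U t2U.
have [|b bP] := ac c.
  move=> t /andP[]; move: (t :&: U) (t :\: U) (setID t U) => t1 t2 <- {t} D1t D2t tr.
  have t1U := s1 _ D1t; have t2U := s2 _ D2t; have [_ _ ct] := split_union t1U t2U.
  rewrite cobd_join //.
  have -> : cobd e (fun s => c (s :|: t2)) t1 =
      (if #|t1| == r1.+1 then cobd e c1 t1 else 0) * c2 t2.
    rewrite /cobd; case: eqP => [t1r|t1r].
      rewrite mulr_suml; apply: eq_bigr => v vt; rewrite cE //; last first.
        by apply: subset_trans t1U; apply: subsetDl.
      by move: t1r; rewrite (cardsD1 v) vt add1n => -[->]; rewrite eqxx mulrA.
    rewrite mul0r big1 // => v vt; rewrite cE //; last first.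
      by apply: subset_trans t1U; apply: subsetDl.
    case: eqP => [E|]; last by rewrite mul0r mulr0.
    by case: t1r; rewrite (cardsD1 v) vt E.
  have -> : cobd e (fun s => c (t1 :|: s)) t2 =
      (if #|t1| == r1 then c1 t1 else 0) * cobd e c2 t2.
    rewrite /cobd mulr_sumr; apply: eq_bigr => v vt; rewrite cE //; last first.
      by apply: subset_trans t2U; apply: subsetDl.
    by rewrite mulrCA.
  case: (eqVneq #|t1| r1.+1) => [t1r|t1r].
    by rewrite c1z // mul0r t1r (gtn_eqF (ltnSn _)) mul0r mulr0 addr0.
  rewrite mul0r add0r; case: eqP => [E|_]; last by rewrite mul0r mulr0.
  by rewrite c2z ?mulr0 //; lia.
exists (fun t2 => (-1) ^+ r1 * \sum_t1 z t1 * b (t1 :|: t2)) => t2 D2t t2r.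
have t2U := s2 _ D2t.
transitivity (\sum_t1 z t1 * c (t1 :|: t2)).
  rewrite -[LHS]mul1r -zc1 mulr_suml; apply: eq_bigr => t1 _.
  case: (boolP (D1 t1 && (#|t1| == r1))) => [/andP[D1t t1r]|/zD->]; last by rewrite !mul0r.
  by rewrite cE ?s1 // t1r mulrA.
transitivity (\sum_t1 (z t1 * cobd e (fun s => b (s :|: t2)) t1 +
     (-1) ^+ r1 * (z t1 * cobd e (fun s => b (t1 :|: s)) t2))).
  apply: eq_bigr => t1 _.
  case: (boolP (D1 t1 && (#|t1| == r1))) => [/andP[D1t /eqP t1r]|/zD->]; last first.
    by rewrite !mul0r mulr0 addr0.
  have t1U := s1 _ D1t; have [E1 E2 ct] := split_union t1U t2U.
  rewrite bP; first by rewrite cobd_join // t1r mulrDr (mulrCA (z _)).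
    by rewrite /join /= E1 E2 D1t.
  by rewrite ct t1r t2r.
rewrite big_split /= zB add0r -mulr_sumr /cobd.
under [RHS]eq_bigr do rewrite mulrCA mulr_sumr.
rewrite -mulr_sumr exchange_big /=; congr (_ * _); apply: eq_bigr => t1 _.
by rewrite mulr_sumr; apply: eq_bigr => v _; rewrite mulrCA.
Qed.

End Join.

(** * Standard signs and transport along injections *)

Section Standard.
Variables (K : fieldType) (V : finType).
Implicit Types (D : pred {set V}) (s t U W : {set V}) (u v x : V).

Definition std_sign (v : V) (t : {set V}) : K :=
  (-1) ^+ #|[set u in t | (enum_rank u < enum_rank v)%N]|.

Lemma std_sign_sq v t : std_sign v t * std_sign v t = 1.
Proof. by rewrite /std_sign -expr2 sqrr_sign. Qed.

Lemma std_sign_system : sign_system std_sign.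
Proof.
split=> [v t|t u v]; first exact: std_sign_sq.
have half (x y : V) : x \in t -> (enum_rank x < enum_rank y)%N ->
    std_sign y t * std_sign x (t :\ y) = - (std_sign x t * std_sign y (t :\ x)).
  move=> xt xy; rewrite /std_sign.
  have -> : [set u0 in t :\ y | (enum_rank u0 < enum_rank x)%N] =
            [set u0 in t | (enum_rank u0 < enum_rank x)%N].
    apply/setP=> z; rewrite !inE; case: (eqVneq z y) => [->|//] /=.
    by rewrite ltnNge (ltnW xy) andbF.
  rewrite (cardsD1 x [set u0 in t | (enum_rank u0 < enum_rank y)%N]) inE xt xy.
  have -> : [set u0 in t | (enum_rank u0 < enum_rank y)%N] :\ x =
            [set u0 in t :\ x | (enum_rank u0 < enum_rank y)%N].
    by apply/setP=> z; rewrite !inE andbA.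
  by rewrite exprS mulN1r mulNr mulrC.
move=> ut vt uv; case: (ltngtP (enum_rank u) (enum_rank v)) => [lt|lt|/val_inj/enum_rank_inj/eqP].
- exact: half.
- by rewrite [in RHS]half // opprK.
- by rewrite (negPf uv).
Qed.

(** A Koszul complex in a multidegree with support [W] has signs of complements in
    [W]; they differ from the standard ones by a factor that depends on [v] only, hence
    form a system of signs as well. *)
Lemma std_sign_setD v W t : t \subset W ->
  std_sign v (W :\: t) = std_sign v W * std_sign v t.
Proof.
move=> tW; rewrite /std_sign.
pose P : {set V} := [set u | (enum_rank u < enum_rank v)%N].
have E s : [set u in s | (enum_rank u < enum_rank v)%N] = s :&: P.
  by apply/setP=> u; rewrite !inE.
rewrite !E; rewrite -(cardsID t (W :&: P)) addnC.
have -> : W :&: P :&: t = t :&: P by rewrite setIAC (setIidPr tW).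
have -> : W :&: P :\: t = (W :\: t) :&: P by rewrite setIDAC.
by rewrite exprD -mulrA -expr2 sqrr_sign mulr1.
Qed.

Definition acyclic D (r : nat) : Prop := acyclic_at std_sign D r.

Lemma acyclic_signP (e : V -> {set V} -> K) D r : sign_system e -> acyclic_at e D r <-> acyclic D r.
Proof. by move=> he; split; apply: acyclic_at_sign => //; apply: std_sign_system. Qed.

Lemma eq_acyclic D D' r : D =1 D' -> acyclic D r <-> acyclic D' r.
Proof. by move=> DD'; split; apply: eq_acyclic_at => // t; rewrite DD'. Qed.

Lemma acyclic_card D r : (forall t, D t -> #|t| != r) -> acyclic D r.
Proof.
move=> Dr c _; exists (fun=> 0) => t Dt /eqP tr.
by have := Dr t Dt; rewrite tr.
Qed.

Lemma acyclic_cone D x r : (forall t, D t -> D (x |: t)) -> acyclic D r.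
Proof. by apply: acyclic_at_cone; apply: std_sign_system. Qed.

End Standard.

Section Transport.
Variables (K : fieldType) (V1 V2 : finType) (f : V1 -> V2).
Hypothesis f_inj : injective f.

Lemma imset_setD1 (s : {set V1}) v : f @: (s :\ v) = (f @: s) :\ f v.
Proof.
apply/setP=> y; apply/imsetP/setD1P => [[x /setD1P[xv xs] ->]|[yv /imsetP[x xs E]]].
  by rewrite (inj_eq f_inj) imset_f.
by exists x => //; rewrite in_setD1 xs andbT; apply: contraNneq yv => <-; rewrite E.
Qed.

(** A numbering of the vertices, or the embedding of an induced subgraph, need not
    respect the standard signs; the cohomology is the same because it does not depend on
    the signs. *)
Lemma acyclic_transport (D : pred {set V2}) r :
    (forall t, D t -> exists s : {set V1}, t = f @: s) ->
  acyclic K D r <-> acyclic K [pred s : {set V1} | D (f @: s)] r.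
Proof.
move=> Df; pose e2 := @std_sign K V2.
pose e1 (v : V1) (s : {set V1}) := e2 (f v) (f @: s).
have he1 : sign_system e1.
  have [sq anti] := std_sign_system K V2.
  split=> [v s|s u v us vs uv]; first exact: sq.
  by rewrite /e1 !imset_setD1 anti ?imset_f // (inj_eq f_inj).
have cobdE c s : cobd e1 (fun s => c (f @: s)) s = cobd e2 c (f @: s).
  rewrite /cobd big_imset /=; last by move=> ? ? _ _; apply: f_inj.
  by apply: eq_bigr => v _; rewrite imset_setD1.
have preK (s : {set V1}) : f @^-1: (f @: s) = s.
  by apply/setP=> y; rewrite inE mem_imset.
rewrite -(acyclic_signP _ _ he1); split=> ac c cz.
  have [|b bP] := ac (fun t : {set V2} => c (f @^-1: t)).
    move=> t Dt tr; have [s tE] := Df t Dt; subst t.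
    rewrite card_imset // in tr; rewrite -(cz s Dt tr) -cobdE.
    by apply: eq_cobd => v _; rewrite preK.
  exists (fun s : {set V1} => b (f @: s)) => s Ds sr.
  by rewrite cobdE -bP ?preK ?card_imset.
have [|b bP] := ac (fun s : {set V1} => c (f @: s)).
  by move=> s Ds sr; rewrite cobdE cz // card_imset.
exists (fun t : {set V2} => b (f @^-1: t)) => t Dt tr; have [s tE] := Df t Dt; subst t.
rewrite card_imset // in tr; rewrite (bP s Dt tr) -cobdE.
by apply: eq_cobd => v _; rewrite preK.
Qed.

End Transport.

(** * Independence complexes of graphs *)

Section Graph.
Variables (K : fieldType) (G : sgraph).
Implicit Types (s t U W : {set G}) (u v x : G).

Definition independent t := [forall u in t, forall v in t, ~~ adj u v].

Lemma independentP t :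
  reflect (forall u v, u \in t -> v \in t -> ~~ adj u v) (independent t).
Proof.
apply: (iffP forall_inP) => [h u v ut vt|h u ut]; first exact: (forall_inP (h u ut)).
by apply/forall_inP => v; apply: h.
Qed.

(** The independence complex of the subgraph induced on [W]. *)
Definition ind_in W : pred {set G} := [pred t : {set G} | (t \subset W) && independent t].

Lemma ind_in_down W : down_closed (ind_in W).
Proof.
move=> s t st /andP[tW /independentP it]; apply/andP; split; first exact: subset_trans tW.
by apply/independentP => u v us vs; apply: it; apply: (subsetP st).
Qed.

(** Through Hochster's formula this bounds the regularity of the subgraph induced
    on [U]. *)
Definition reg_le U R : Prop :=
  forall W r, W \subset U -> (R < r)%N -> acyclic K (ind_in W) r.

Lemma reg_le_sub U U' R R' : U \subset U' -> (R' <= R)%N -> reg_le U' R' -> reg_le U R.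
Proof.
move=> UU' R'R h W r WU Rr; apply: h; [exact: subset_trans UU' | exact: leq_ltn_trans Rr].
Qed.

(** The counterpart of [reg (S/I) <= max (reg (S/(I, x))) (reg (S/(I : x)) + 1)]. *)
Lemma reg_le_del_link U x R :
  reg_le (U :\ x) R.+1 ->
  reg_le [set v in U :\ x | ~~ adj x v] R -> reg_le U R.+1.
Proof.
move=> hd hl W [//|r] WU Rr.
have [xW|xW] := boolP (x \in W); last first.
  by apply: hd => //; rewrite subsetD1 WU.
apply: (acyclic_at_del_link (x := x) (std_sign_system K G) (ind_in_down (W := W))).
- have : acyclic K (ind_in (W :\ x)) r.+1 by apply: hd => //; apply: setSD.
  apply: eq_acyclic_at => t; rewrite /ind_in /= subsetD1.
  by rewrite -!andbA; congr (_ && _); rewrite andbC.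
- have : acyclic K (ind_in [set v in W :\ x | ~~ adj x v]) r.
    apply: hl => //; apply/subsetP=> v; rewrite !inE => /andP[/andP[-> vW] ->].
    by rewrite (subsetP WU).
  apply: eq_acyclic_at => t; rewrite /ind_in /=; apply/andP/andP.
    move=> [/subsetP tW /independentP it]; split; last first.
      by apply/negP => /tW; rewrite !inE eqxx.
    apply/andP; split.
      by apply/subsetP=> v /setU1P[->//|/tW]; rewrite !inE => /andP[/andP[]].
    apply/independentP => u v /setU1P[->|ut] /setU1P[->|vt]; first by rewrite adj_irr.
    - by have := tW v vt; rewrite !inE => /andP[].
    - by have := tW u ut; rewrite !inE adj_sym => /andP[].
    - exact: it.
  move=> [/andP[/subsetP tW /independentP it] xt]; split.
    apply/subsetP=> v vt; rewrite !inE tW ?setU1r // it ?setU11 ?setU1r // andbT andbT.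
    by apply: contraNneq xt => <-.
  by apply/independentP => u v ut vt; apply: it; apply: setU1r.
Qed.

Lemma ind_in_join U W : (forall u v, u \in W :&: U -> v \in W :\: U -> ~~ adj u v) ->
  ind_in W =1 join U (ind_in (W :&: U)) (ind_in (W :\: U)).
Proof.
move=> nadj t; rewrite /ind_in /join /=; apply/andP/andP.
  move=> [tW /independentP it]; rewrite !setSI ?setSD //; split; apply/independentP => u v.
    by rewrite !inE => /andP[ut _] /andP[vt _]; apply: it.
  by rewrite !inE => /andP[_ ut] /andP[_ vt]; apply: it.
move=> [/andP[t1 /independentP it1] /andP[t2 /independentP it2]]; split.
  by rewrite -(setID t U) -(setID W U) setUSS.
apply/independentP => u v ut vt.
case: (boolP (u \in U)) => uU; case: (boolP (v \in U)) => vU.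
- by apply: it1; rewrite inE ?ut ?vt.
- by apply: nadj; [apply: (subsetP t1)|apply: (subsetP t2)]; rewrite inE ?ut ?vt ?vU.
- rewrite adj_sym.
  by apply: nadj; [apply: (subsetP t1)|apply: (subsetP t2)]; rewrite inE ?ut ?vt ?uU.
- by apply: it2; rewrite inE ?ut ?vt ?uU ?vU.
Qed.

Lemma ind_in_sub W t : ind_in W t -> t \subset W.
Proof. by case/andP. Qed.

Lemma reg_le_union U1 U2 R1 R2 : (forall u v, u \in U1 -> v \in U2 -> ~~ adj u v) ->
  reg_le U1 R1 -> reg_le U2 R2 -> reg_le (U1 :|: U2) (R1 + R2).
Proof.
move=> nadj h1 h2 W r WU Rr.
have W2 : W :\: U1 \subset U2.
  by apply/subsetP=> v; rewrite inE => /andP[/negPf vU /(subsetP WU)]; rewrite inE vU.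
apply/(eq_acyclic _ _ (ind_in_join (U := U1) _)).
  move=> u v; rewrite inE => /andP[_ uU] /(subsetP W2); exact: nadj.
apply: (join_acyclic (R1 := R1) (R2 := R2)) => //.
- exact: std_sign_system.
- exact: ind_in_down.
- exact: ind_in_down.
- by move=> t /ind_in_sub tW; apply: subset_trans tW (subsetIr _ _).
- by move=> t /ind_in_sub tW; apply: subset_trans tW _; rewrite setDE subsetIr.
- by move=> q; apply: h1; apply: subsetIr.
- by move=> q; apply: h2.
Qed.

Lemma nonacyclic_union W1 W2 r1 r2 : W2 \subset ~: W1 ->
    (forall u v, u \in W1 -> v \in W2 -> ~~ adj u v) ->
  ~ acyclic K (ind_in W1) r1 -> ~ acyclic K (ind_in W2) r2 ->
  ~ acyclic K (ind_in (W1 :|: W2)) (r1 + r2).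
Proof.
move=> W21 nadj n1 n2.
have [E1 E2 _] := split_union (subxx W1) W21.
have nadj' u v : u \in (W1 :|: W2) :&: W1 -> v \in (W1 :|: W2) :\: W1 -> ~~ adj u v.
  by rewrite E1 E2; apply: nadj.
move/(eq_acyclic _ _ (ind_in_join nadj')); rewrite E1 E2.
apply: join_nonacyclic n1 n2; first exact: std_sign_system.
- by move=> t /ind_in_sub.
- by move=> t /ind_in_sub tW; apply: subset_trans tW W21.
Qed.

Lemma nonacyclic_set0 : ~ acyclic K (ind_in set0) 0.
Proof.
move=> ac; have [|b bP] := ac (fun=> 1).
  by move=> t /ind_in_sub; rewrite subset0 => /eqP->; rewrite cards0.
have ind0 : ind_in set0 (set0 : {set G}).
  by rewrite /ind_in /= subxx; apply/independentP => u v; rewrite inE.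
have /eqP := bP set0 ind0 (cards0 _).
by rewrite /cobd big_set0 oner_eq0.
Qed.

(** The independence complex of an edge consists of two points, so it is not
    connected. *)
Lemma nonacyclic_edge u v : adj u v -> ~ acyclic K (ind_in [set u; v]) 1.
Proof.
move=> uv ac; pose c t : K := (t == [set u])%:R.
have nuv : u != v by apply: contraTneq uv => ->; rewrite adj_irr.
have [|b bP] := ac c.
  move=> t /andP[tuv /independentP it] t2; have tE : t = [set u; v].
    by apply/eqP; rewrite eqEcard tuv cards2 nuv t2.
  by have := it u v; rewrite tE !inE !eqxx orbT uv => /(_ isT isT).
have ind1 x : x \in [set u; v] -> ind_in [set u; v] [set x].
  move=> xuv; rewrite /ind_in /= sub1set xuv; apply/independentP => y z.
  by rewrite !inE => /eqP-> /eqP->; rewrite adj_irr.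
have cob1 x : cobd (@std_sign K G) b [set x] = std_sign K x [set x] * b set0.
  by rewrite /cobd big_set1 setDv.
have := bP [set v]; rewrite ind1 ?set22 // cards1 cob1 /c => /(_ isT erefl).
rewrite (inj_eq set1_inj) eq_sym (negPf nuv) => /esym/eqP.
rewrite mulf_eq0 (negPf (sign_neq0 _ _ (std_sign_system K G))) /= => /eqP b0.
have := bP [set u]; rewrite ind1 ?set21 // cards1 cob1 /c b0 eqxx mulr0 => /(_ isT erefl).
by move/eqP; rewrite oner_eq0.
Qed.

End Graph.

Lemma ind_in_transport (K : fieldType) (G H : sgraph) (f : H -> G) (W : {set H}) r :
    injective f -> (forall u v, adj (f u) (f v) = adj u v) ->
  acyclic K (ind_in (f @: W)) r <-> acyclic K (ind_in W) r.
Proof.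
move=> f_inj fadj; rewrite (acyclic_transport K f_inj); last first.
  move=> t /ind_in_sub tW; exists (f @^-1: t).
  apply/setP=> y; apply/idP/imsetP => [yt|[x]]; last by rewrite inE => xt ->.
  by have /imsetP[x _ yE] := subsetP tW y yt; exists x; rewrite ?inE -?yE.
apply: eq_acyclic => t; rewrite /ind_in /=; congr (_ && _).
  apply/idP/idP => [/subsetP h|]; last exact: imsetS.
  by apply/subsetP=> x xt; have := h (f x); rewrite !mem_imset //; apply.
apply/independentP/independentP => it u v.
  by move=> ut vt; rewrite -fadj it // imset_f.
by move=> /imsetP[x xt ->] /imsetP[y yt ->]; rewrite fadj it.
Qed.

(** * Isolated vertices *)

(** The nonzero squarefree monomials modulo the edge ideal: an isolated vertex is a
    generator of the ideal, hence not a face. *)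
Definition face (G : sgraph) : pred {set G} :=
  [pred t : {set G} | independent t && [forall v in t, ~~ isolated v]].

Definition face_in (G : sgraph) (W : {set G}) : pred {set G} :=
  [pred t : {set G} | (t \subset W) && face t].

(** By Hochster's formula, [reg (S/I(G))] is the largest such [r]. *)
Definition homological (K : fieldType) (G : sgraph) (r : nat) : Prop :=
  exists W : {set G}, ~ acyclic K (face_in W) r.

Lemma face_in_nonisolated (G : sgraph) (W : {set G}) :
  face_in W =1 ind_in (W :\: [set v | isolated v]).
Proof.
move=> t; rewrite /face_in /face /ind_in /= subsetD [RHS]andbAC -andbA.
congr (_ && _); congr (_ && _).
apply/forall_inP/pred0P => [h v|h v vt].
  by rewrite !inE; apply/negP => /andP[/h/negP].
by have := h v; rewrite !inE vt => /negbT.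
Qed.

(** If [W] contains an isolated vertex, the independence complex of [W] is a cone over
    it; otherwise all its faces are faces of the complex of the edge ideal. *)
Lemma reg_le_homological (K : fieldType) (G : sgraph) R :
  (forall r, homological K G r -> (r <= R)%N) -> reg_le K [set: G] R.
Proof.
move=> h W r _ Rr; apply: NNPP => nac.
have [[x /andP[xW xi]]|/not_ex_all_not none] := classic (exists x, (x \in W) && isolated x).
  apply: nac; apply: (acyclic_cone (x := x)) => t /andP[tW /independentP it].
  apply/andP; split; first by rewrite subUset sub1set xW.
  have xN y : ~~ adj x y by exact: (forallP xi).
  apply/independentP => u v /setU1P[->|ut] /setU1P[->|vt] //; first by rewrite adj_sym.
  exact: it.
have : (r <= R)%N; last by rewrite leqNgt Rr.
apply: h; exists W => /(eq_acyclic _ _ (face_in_nonisolated W)).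
suff -> : W :\: [set v | isolated v] = W by [].
apply/setDidPl; rewrite disjoints_subset; apply/subsetP=> x xW; rewrite !inE.
by apply/negP => xi; have := none x; rewrite xW xi.
Qed.

Lemma homological_ind (K : fieldType) (G : sgraph) r :
  homological K G r -> exists W : {set G}, ~ acyclic K (ind_in W) r.
Proof.
by move=> [W] /(eq_acyclic _ _ (face_in_nonisolated W)); exists (W :\: [set v | isolated v]).
Qed.

Lemma homologicalP (K : fieldType) (G : sgraph) r : (forall v : G, ~~ isolated v) ->
  homological K G r <-> exists W : {set G}, ~ acyclic K (ind_in W) r.
Proof.
move=> noi; split=> [|[W nac]]; first exact: homological_ind.
exists W; move/(eq_acyclic _ _ (face_in_nonisolated W)).
suff -> : W :\: [set v | isolated v] = W by [].
by apply/setDidPl; rewrite disjoints_subset; apply/subsetP=> x _; rewrite !inE.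
Qed.

(** * Independence complexes of coronas *)

Section Corona.
Variables (K : fieldType) (X H : sgraph).
Local Notation G := (corona X H).
Implicit Types (A B : {set X}) (W : {set H}).

(** The parts of the corona that occur when vertices of [X] are deleted or replaced
    by their links: [A] is the set of vertices of [X] that remain, [B] indexes the copies
    of [H] that remain. *)
Definition corona_part A B : {set G} :=
  [set v : G | match v with inl x => x \in A | inr (x, _) => x \in B end].

Definition copy (x : X) (h : H) : G := inr (x, h).

Lemma copy_inj x : injective (copy x).
Proof. by move=> h k []. Qed.

Lemma adj_copy x h k : adj (copy x h) (copy x k) = adj h k.
Proof. by rewrite /= eqxx. Qed.

Lemma set_card_ind (T : finType) (P : {set T} -> Prop) :
    P set0 -> (forall (x : T) (B : {set T}), x \notin B -> P B -> P (x |: B)) ->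
  forall B : {set T}, P B.
Proof.
move=> P0 PU B; move En: #|B| => n; elim: n B En => [|n IH] B En.
  by rewrite (cards0_eq En).
have /card_gt0P[x xB] : (0 < #|B|)%N by rewrite En.
rewrite -(setD1K xB); apply: PU; first by rewrite setD11.
by apply: IH; move: En; rewrite (cardsD1 x) xB add1n => -[].
Qed.

(** Disjoint unions of graphs have joins as independence complexes, and regularities
    add up. *)
Lemma reg_le_copies R B : reg_le K [set: H] R ->
  reg_le K (corona_part set0 B) (#|B| * R).
Proof.
move=> hH; elim/set_card_ind: B => [|x B xB IH].
  move=> W r; rewrite cards0 mul0n => /subsetP W0 r0; apply: acyclic_card => t /ind_in_sub tW.
  apply: contraTneq r0 => <-; rewrite -leqNgt leqn0 cards_eq0.
  apply/eqP/setP=> v; rewrite inE; apply/negP => /(subsetP tW)/W0.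
  by case: v => [y|[y h]]; rewrite !inE.
rewrite cardsU1 xB mulnDl mul1n.
have -> : corona_part set0 (x |: B) = corona_part set0 [set x] :|: corona_part set0 B.
  by apply/setP=> -[y|[y h]]; rewrite !inE.
apply: reg_le_union => //.
  move=> [y|[y h]] [z|[z k]]; rewrite ?inE //= => /eqP-> zB.
  by apply/negP => /andP[/eqP E _]; rewrite E zB in xB.
move=> W r Wx Rr.
have -> : W = copy x @: (copy x @^-1: W).
  apply/setP=> v; apply/idP/imsetP => [vW|[h]]; last by rewrite inE => hW ->.
  case: v vW => [y|[y h]] vW; have := subsetP Wx _ vW; rewrite ?inE // => /eqP E.
  by subst y; exists h; rewrite ?inE.
apply/(ind_in_transport _ _ _ (@copy_inj x) (adj_copy x)).
by apply: hH; rewrite ?subsetT.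
Qed.

Lemma corona_part_del A B a : corona_part A B :\ inl a = corona_part (A :\ a) B.
Proof. by apply/setP=> -[x|[x h]]; rewrite !inE. Qed.

(** The link of [a] lacks not only [a] but the whole copy of [H] at [a].  As this copy
    accounts for [R >= 1], the link meets the bound decreased by one. *)
Lemma reg_le_corona_pos R A B : (0 < R)%N -> reg_le K [set: H] R ->
  A \subset B -> reg_le K (corona_part A B) (#|B| * R).
Proof.
move=> R0 hH; elim/set_card_ind: A B => [|a A aA IH] B; first by move=> _; apply: reg_le_copies.
rewrite subUset sub1set => /andP[aB AB].
have BE : #|B| = #|B :\ a|.+1 by rewrite (cardsD1 a) aB.
have BR0 : (0 < #|B| * R)%N by rewrite muln_gt0 R0 BE.
rewrite -(prednK BR0).
apply: (reg_le_del_link (x := (inl a : G))).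
  by rewrite corona_part_del setU1K // prednK //; apply: IH.
apply: (reg_le_sub (U' := corona_part A (B :\ a)) (R' := (#|B :\ a| * R)%N)).
- apply/subsetP=> -[x|[x h]]; rewrite !inE /=.
    by case/andP=> /andP[xa /orP[/eqP E|//]]; rewrite E eqxx in xa.
  by case/andP=> -> ax; rewrite eq_sym ax.
- by rewrite BE mulSn; lia.
- apply: IH; apply/subsetP=> x xA; rewrite !inE (subsetP AB) // andbT.
  by apply: contraNneq aA => <-.
Qed.

(** When the copies of [H] contribute nothing, each vertex of [X] contributes at most
    one. *)
Lemma reg_le_corona0 A B : reg_le K [set: H] 0 -> reg_le K (corona_part A B) #|A|.
Proof.
move=> hH; elim/set_card_ind: A => [|a A aA IH].
  by have := reg_le_copies (B := B) hH; rewrite muln0 cards0.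
rewrite cardsU1 aA; apply: (reg_le_del_link (x := (inl a : G))).
  rewrite corona_part_del setU1K //; apply: reg_le_sub IH => //; exact: leqnSn.
apply: reg_le_sub IH => //; apply/subsetP=> -[x|[x h]]; rewrite !inE /=.
  by case/andP=> /andP[/eqP xa /orP[/eqP xa'|//]]; case: xa; rewrite xa'.
by case/andP.
Qed.

Definition copies B W : {set G} :=
  [set v : G | if v is inr (x, h) then (x \in B) && (h \in W) else false].

Definition whiskers (h : H) A : {set G} :=
  [set v : G | match v with inl x => x \in A | inr (x, k) => (x \in A) && (k == h) end].

Lemma nonacyclic_copies W r B : ~ acyclic K (ind_in W) r ->
  ~ acyclic K (ind_in (copies B W)) (#|B| * r).
Proof.
move=> nac; elim/set_card_ind: B => [|x B xB IH].
  rewrite cards0 mul0n.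
  suff -> : copies set0 W = set0 by apply: nonacyclic_set0.
  by apply/setP=> -[y|[y h]]; rewrite !inE.
rewrite cardsU1 xB mulnDl mul1n.
have -> : copies (x |: B) W = copy x @: W :|: copies B W.
  apply/setP=> -[y|[y h]]; rewrite !inE.
    by rewrite orbF; apply/esym/negbTE/imsetP => -[].
  rewrite andb_orl; congr (_ || _).
  apply/andP/imsetP => [[/eqP-> hW]|[k kW [-> ->]]]; last by rewrite eqxx.
  by exists h.
apply: nonacyclic_union IH => //.
- apply/subsetP=> -[y|[y h]]; rewrite !inE //.
  case/andP=> yB _; apply/imsetP => -[k _ [yx _]]; by rewrite -yx yB in xB.
- move=> u [y|[y h]] /imsetP[k kW ->]; rewrite inE // => /andP[yB _] /=.
  by apply/negP => /andP[/eqP E _]; rewrite E yB in xB.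
by move/(ind_in_transport _ _ _ (@copy_inj x) (adj_copy x)).
Qed.

(** Each [a] in [A], with the vertex [h] of its copy of [H], spans an edge, and these
    edges form an induced matching. *)
Lemma nonacyclic_whiskers (h : H) A : (forall x y, x \in A -> y \in A -> ~~ adj x y) ->
  ~ acyclic K (ind_in (whiskers h A)) #|A|.
Proof.
elim/set_card_ind: A => [|a A aA IH] Aind.
  rewrite cards0; suff -> : whiskers h set0 = set0 by apply: nonacyclic_set0.
  by apply/setP=> -[y|[y k]]; rewrite !inE.
rewrite cardsU1 aA.
have -> : whiskers h (a |: A) = [set (inl a : G); (inr (a, h) : G)] :|: whiskers h A.
  apply/setP=> -[y|[y k]]; rewrite !inE; first by rewrite /= orbF.
  by rewrite andb_orl.
apply: nonacyclic_union.
- apply/subsetP=> -[y|[y k]]; rewrite !inE.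
    by move=> yA; rewrite orbF; apply: contraNneq aA => -[<-].
  by case/andP=> yA _; apply: contraNneq aA => -[<- _].
- move=> u v; rewrite !inE => /orP[]/eqP-> {u}; case: v => [y|[y k]] /=.
  + by move=> yA; apply: Aind; rewrite !inE ?eqxx ?yA ?orbT.
  + by case/andP=> yA _; apply: contraNneq aA => ->.
  + by move=> yA; apply: contraNneq aA => ->.
  + by case/andP=> yA _; apply/negP=> /andP[/eqP E _]; rewrite E yA in aA.
- by apply: nonacyclic_edge => /=.
apply: IH => x y xA yA; by apply: Aind; rewrite inE ?xA ?yA orbT.
Qed.

Lemma corona_not_isolated (v : G) : (0 < #|H|)%N -> ~~ isolated v.
Proof.
case/card_gt0P => h _; rewrite negb_forall; case: v => [x|[x k]].
  by apply/existsP; exists (inr (x, h)); rewrite /= eqxx.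
by apply/existsP; exists (inl x); rewrite /= eqxx.
Qed.

End Corona.

Lemma reg_le_not_homological (K : fieldType) (G : sgraph) R r :
  reg_le K [set: G] R -> (forall v : G, ~~ isolated v) ->
  homological K G r -> (r <= R)%N.
Proof.
move=> h noi /(homologicalP _ _ noi)[W nac]; rewrite leqNgt; apply/negP => Rr.
by apply: nac; apply: h; rewrite ?subsetT.
Qed.

Lemma corona_part_setT (X H : sgraph) :
  @corona_part X H [set: X] [set: X] = [set: corona X H].
Proof. by apply/setP=> -[x|[x h]]; rewrite !inE. Qed.

(** If [H] has an edge, the [n + 1] copies of [H] alone reach the upper bound.  If [H]
    has none, [H] contributes 0, the [n] leaves with their whiskers form an induced
    matching, and the centre adds nothing: its link contains no vertex of the star, so the
    link has regularity 0 and can be neglected since [n >= 1]. *)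
Lemma star_corona_top (K : fieldType) (n : nat) (H : sgraph) r0 :
    (0 < n)%N -> (0 < #|H|)%N -> homological K H r0 ->
    (forall r, homological K H r -> (r <= r0)%N) ->
  let R := if null_graph H then n else (n.+1 * r0)%N in
  homological K (corona (star n) H) R /\
  (forall r, homological K (corona (star n) H) r -> (r <= R)%N).
Proof.
move=> n0 H0 hr0 r0max; have noi v := @corona_not_isolated (star n) H v H0.
have hH := reg_le_homological r0max.
have cX : #|[set: star n]| = n.+1 by rewrite cardsT card_ord.
case: ifP => nullH /=; last first.
  have r0gt : (0 < r0)%N.
    move/negbT: nullH; rewrite negb_forall => /existsP[u]; rewrite negb_forall => /existsP[v].
    rewrite negbK => uv; apply: r0max; exists [set u; v].
    move/(eq_acyclic _ _ (face_in_nonisolated _)).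
    suff -> : [set u; v] :\: [set x | isolated x] = [set u; v] by apply: nonacyclic_edge.
    apply/setDidPl; rewrite disjoints_subset; apply/subsetP=> x; rewrite !inE negb_forall.
    by case/orP=> /eqP->; apply/existsP; [exists v|exists u]; rewrite negbK // adj_sym.
  split.
    have [W nac] := homological_ind hr0; apply/(homologicalP _ _ noi).
    have := nonacyclic_copies (X := star n) (B := setT) nac; rewrite cX => nac'.
    by eexists; apply: nac'.
  move=> r; apply: reg_le_not_homological => //; rewrite -corona_part_setT -cX.
  exact: reg_le_corona_pos.
have r00 : r0 = 0%N.
  have [W nac] := homological_ind hr0; apply/eqP; rewrite -leqn0 leqNgt; apply/negP => r0gt.
  have [[x xW]|/not_ex_all_not none] := classic (exists x, x \in W); last first.
    apply: nac; apply: acyclic_card => t /ind_in_sub tW; apply: contraTneq r0gt => <-.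
    rewrite -leqNgt leqn0 cards_eq0; apply/eqP/setP=> v; rewrite inE; apply/negP => vt.
    by case: (none v); apply: (subsetP tW).
  apply: nac; apply: (acyclic_cone (x := x)) => t /andP[tW _]; apply/andP; split.
    by rewrite subUset sub1set xW.
  by apply/independentP => u v _ _; apply: (forallP (forallP nullH u)).
rewrite r00 in hH; split.
  have /card_gt0P[h _] := H0.
  apply/(homologicalP _ _ noi); eexists.
  have := @nonacyclic_whiskers K (star n) H h [set~ ord0]; rewrite cardsC1 card_ord /=; apply.
  by move=> x y; rewrite !inE /star_adj => /negPf-> /negPf->.
move=> r; apply: reg_le_not_homological => //; rewrite -corona_part_setT.
suff: reg_le K (@corona_part (star n) H setT setT) n.-1.+1 by rewrite prednK.
apply: (reg_le_del_link (x := (inl ord0 : corona (star n) H))).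
  rewrite corona_part_del prednK //.
  have := @reg_le_corona0 K (star n) H (setT :\ ord0) setT hH.
  by rewrite setTD cardsC1 card_ord.
apply: (reg_le_sub (U' := @corona_part (star n) H set0 setT) (R' := 0%N)) => //.
  apply/subsetP=> -[x|[x h]]; rewrite !inE //= /star_adj eqxx.
  case/andP=> x0; rewrite negbK => /eqP xE.
  by rewrite xE eqxx in x0.
by have := @reg_le_corona0 K (star n) H set0 setT hH; rewrite cards0.
Qed.

(** * The Koszul complex *)

Lemma std_sign_U1 (K : fieldType) (V : finType) (v : V) t :
  std_sign K v (v |: t) = std_sign K v t.
Proof.
rewrite /std_sign; congr (_ ^+ #|pred_of_set _|); apply/setP=> u; rewrite !inE.
by case: eqP => // ->; rewrite ltnn !andbF.
Qed.

Lemma sign_system_scale (K : fieldType) (V : finType) (k : V -> K) e :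
  (forall v, k v * k v = 1) -> sign_system e -> sign_system (fun v t => k v * e v t).
Proof.
move=> k2 [e2 eN]; split=> [v t|t u v ut vt uv]; first by rewrite mulrACA k2 e2 mulr1.
by rewrite mulrACA eN // mulrN [in RHS]mulrACA (mulrC (k v)).
Qed.

Section Koszul.
Variables (K : fieldType) (n : nat).
Local Notation S := {mpoly K[n]}.
Implicit Types (s t : {set 'I_n}) (m a : 'X_{1..n}) (p q : S).

Definition mset s : 'X_{1..n} := [multinom (i \in s : nat) | i < n].
Definition msupport m : {set 'I_n} := [set i | m i != 0%N].

(** The part of a polynomial supported on the monomials in [P], such as a homogeneous
    or a multigraded component. *)
Definition mfilter (P : pred 'X_{1..n}) p : S := \sum_(m <- msupp p | P m) p@_m *: 'X_[m].

Lemma mcoeff_mfilter P p m : (mfilter P p)@_m = if P m then p@_m else 0.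
Proof.
rewrite /mfilter raddf_sum /=.
under eq_bigr do rewrite mcoeffZ mcoeffX.
case: (boolP (m \in msupp p)) => mp; last first.
  rewrite (memN_msupp_eq0 mp) if_same big_seq_cond big1 // => k /andP[kp _].
  by rewrite (negPf (_ : k != m)) ?mulr0 //; apply: contraNneq mp => <-.
rewrite big_mkcond (bigD1_seq m) ?msupp_uniq //= eqxx mulr1 big1 ?addr0 // => k /negPf km.
by rewrite km mulr0 if_same.
Qed.

Lemma mcoeff_mulX p k m : (p * 'X_[k])@_m = if (k <= m)%MM then p@_(m - k) else 0.
Proof.
case: ifP => km; first by rewrite -{1}(submK km) addmC mcoeffMX.
apply: memN_msupp_eq0; rewrite (perm_mem (msuppMX p k)).
by apply/mapP => -[j _ E]; rewrite E lem_addr in km.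
Qed.

(** [w s] is the coefficient of the exterior product of the basis vectors in [s], so
    that the Koszul differential goes from sets of size [k + 1] to sets of size [k]. *)
Definition kosz (M : lmodType S) (w : {set 'I_n} -> M) s : M :=
  \sum_(v in ~: s) (std_sign K v s *: 'X_v) *: w (v |: s).

Lemma eq_kosz (M : lmodType S) (w w' : {set 'I_n} -> M) s :
  (forall t, #|t| = #|s|.+1 -> w t = w' t) -> kosz w s = kosz w' s.
Proof.
move=> ww; apply: eq_bigr => v; rewrite inE => vs; congr (_ *: _).
by apply: ww; rewrite cardsU1 vs.
Qed.

Lemma kosz_kosz (M : lmodType S) (w : {set 'I_n} -> M) s : kosz (kosz w) s = 0.
Proof.
rewrite /kosz; under eq_bigr do rewrite scaler_sumr.
have E v : ~: (v |: s) = (~: s) :\ v.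
  by apply/setP=> u; rewrite !inE negb_or.
under eq_bigr do rewrite E.
apply: sum_antisym => u v; rewrite !inE => us vs uv.
rewrite !scalerA setUCA -scaleNr; congr (_ *: _).
have XC : 'X_u * 'X_v = 'X_v * 'X_u :> S by rewrite mulrC.
rewrite -!scalerAl -!scalerAr !scalerA XC -scaleNr; congr (_ *: _).
have [_ anti] := std_sign_system K 'I_n.
have := anti (u |: (v |: s)) u v (setU11 _ _) (setU1r _ (setU11 _ _)) uv.
have -> : (u |: (v |: s)) :\ v = u |: s.
  rewrite setUCA setU1K // !inE negb_or vs andbT eq_sym; exact: uv.
rewrite setU1K ?inE ?negb_or ?us ?uv //.
rewrite {1}setUCA !std_sign_U1 => E1.
by rewrite (mulrC (std_sign K u s)) E1 opprK mulrC.
Qed.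

Lemma koszB (M : lmodType S) (w w' : {set 'I_n} -> M) s :
  kosz (fun t => w t - w' t) s = kosz w s - kosz w' s.
Proof. by rewrite /kosz -sumrB; apply: eq_bigr => v _; rewrite scalerBr. Qed.

Lemma mset_le s a : (mset s <= a)%MM = (s \subset msupport a).
Proof.
apply/mnm_lepP/subsetP => [h i si|h i]; first by have := h i; rewrite mnmE si inE lt0n.
by rewrite mnmE; case: (boolP (i \in s)) => // /h; rewrite inE lt0n.
Qed.

Lemma mset_U1 s v a : v \notin s -> (a - mset (v |: s) = a - mset s - U_(v))%MM.
Proof.
move=> vs; apply/mnmP => i; rewrite !mnmBE !mnmE !inE (eq_sym v).
case: eqP => [->|_]; first by rewrite (negPf vs) /= subn0.
by rewrite subn0.
Qed.

Lemma mcoeff_kosz (w : {set 'I_n} -> S^o) s a : s \subset msupport a ->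
  (kosz w s)@_(a - mset s) = \sum_(v in msupport a :\: s)
     std_sign K v s * (w (v |: s) : S)@_(a - mset (v |: s)).
Proof.
move=> sa.
have termE v : ((std_sign K v s *: 'X_v) *: w (v |: s) : S)@_(a - mset s) =
    std_sign K v s * (if (U_(v) <= a - mset s)%MM
                      then (w (v |: s) : S)@_(a - mset s - U_(v)) else 0).
  rewrite -[X in X@__]/((std_sign K v s *: 'X_v) * (w (v |: s) : S)).
  by rewrite -scalerAl mcoeffZ mulrC [_ * (w _ : S)]mulrC mcoeff_mulX mulrC.
rewrite /kosz raddf_sum /=; under eq_bigr do rewrite termE.
rewrite (bigID (mem (msupport a))) /= [X in _ + X]big1.
  rewrite addr0; apply: eq_big => [v|v]; first by rewrite !inE.
  rewrite !inE => /andP[vs va]; rewrite mset_U1 // ifT //.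
  apply/mnm_lepP => i; rewrite mnmE mnmBE mnmE; case: eqP => // <-.
  by rewrite (negPf vs) subn0 lt0n.
move=> v; rewrite !inE negbK => /andP[vs /eqP va].
rewrite ifF ?mulr0 //; apply/negP => /mnm_lepP/(_ v).
by rewrite mnmE mnmBE va eqxx sub0n.
Qed.

(** The Stanley-Reisner ideal of [D]. *)
Definition sr_ideal (D : pred {set 'I_n}) p : Prop := forall m, D (msupport m) -> p@_m = 0.

(** In multidegree [a], the Koszul complex of the quotient by [sr_ideal D] has a basis
    of the sets [s] for which the monomial of exponent [a - mset s] is not in the ideal.
    With [t = msupport a :\: s] this becomes the cochain complex of a family of sets: the
    support of [a - mset s] consists of [t] and of the variables of exponent at least 2 in
    [a]. *)
Definition degree_faces (D : pred {set 'I_n}) a : pred {set 'I_n} :=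
  [pred t : {set 'I_n} | (t \subset msupport a) && D (t :|: [set i | 1 < a i]%N)].

Lemma msupport_sub s a : s \subset msupport a ->
  msupport (a - mset s)%MM = (msupport a :\: s) :|: [set i | 1 < a i]%N.
Proof.
move=> sa; apply/setP=> i; rewrite !inE mnmBE mnmE.
case: (boolP (i \in s)) => [/(subsetP sa)|_]; rewrite ?inE /=; lia.
Qed.

Lemma sub_setDK (T : finType) (A B : {set T}) : B \subset A -> A :\: (A :\: B) = B.
Proof. by move=> BA; rewrite setDDr setDv set0U; apply/setIidPr. Qed.

Lemma setDU1 (T : finType) (A B : {set T}) x : A :\: (x |: B) = (A :\: B) :\ x.
Proof. by rewrite setDDl setUC. Qed.

Lemma setDD1 (T : finType) (A B : {set T}) x : B \subset A -> x \in B ->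
  A :\: (B :\ x) = x |: (A :\: B).
Proof.
move=> BA xB; apply/setP=> y; rewrite !inE; case: eqP => [->|] //=.
exact: (subsetP BA).
Qed.

(** The Koszul complex is the direct sum of its multigraded components, and the
    component of degree [a] is the cochain complex of [degree_faces D a]. *)
Lemma koszul_bounds (D : pred {set 'I_n}) (Q : pred 'X_{1..n}) (k : nat)
    (w : {set 'I_n} -> S^o) :
    (forall a, Q a -> (k <= #|msupport a|)%N ->
       acyclic K (degree_faces D a) (#|msupport a| - k)) ->
    (forall s, #|s|.+1 = k -> sr_ideal D (kosz w s)) ->
  exists y : {set 'I_n} -> S^o, forall s, #|s| = k ->
    sr_ideal D (mfilter (fun m => Q (m + mset s)%MM) (w s) - kosz y s).
Proof.
move=> ac cyc.
pose c a t := (w (msupport a :\: t) : S)@_(a - mset (msupport a :\: t)).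
pose e a v t := std_sign K v (msupport a) * std_sign K v t.
have he a : sign_system (e a).
  by apply: sign_system_scale (std_sign_system K _) => v; apply: std_sign_sq.
have eE a v t : t \subset msupport a -> e a v t = std_sign K v (msupport a :\: t).
  by move=> ta; rewrite std_sign_setD.
have [B BP] : exists B : 'X_{1..n} -> {set 'I_n} -> K, forall a, Q a ->
    (k <= #|msupport a|)%N -> forall t, degree_faces D a t ->
    #|t| = (#|msupport a| - k)%N -> c a t = cobd (e a) (B a) t.
  apply: (@prop_choice _ _ (fun a Ba => Q a -> (k <= #|msupport a|)%N ->
    forall t, degree_faces D a t -> #|t| = (#|msupport a| - k)%N -> c a t = cobd (e a) Ba t)) => a.
  case: (boolP (Q a)) => [Qa|_]; last by exists (fun=> 0).
  case: (boolP (k <= #|msupport a|)%N) => [ka|_]; last by exists (fun=> 0).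
  have [|b bP] := (acyclic_signP _ _ (he a)).2 (ac a Qa ka) (c a); last by exists b.
  move=> t /andP[ta Dt] tk; set s := msupport a :\: t.
  have sa : s \subset msupport a by apply: subsetDl.
  have ts : msupport a :\: s = t by rewrite sub_setDK.
  have cs : #|s|.+1 = k by have := subset_leq_card ta;
    have := cardsD (msupport a) t; rewrite (setIidPr ta) -/s; lia.
  have := cyc s cs (a - mset s)%MM; rewrite msupport_sub // ts => /(_ Dt).
  rewrite mcoeff_kosz // ts => <-; apply: eq_bigr => v vt.
  by rewrite eE // /c setDD1.
pose As := undup (flatten
  [seq [seq (m + mset s)%MM | m <- msupp (w s : S)] | s <- enum {set 'I_n}]).
have memAs s m : (w s : S)@_m != 0 -> (m + mset s)%MM \in As.
  move=> wm; rewrite mem_undup; apply/flatten_mapP; exists s; first by rewrite mem_enum.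
  by apply/mapP; exists m => //; rewrite mcoeff_msupp.
(* The solutions [B a] in the finitely many degrees [a] that occur in [w], reassembled. *)
pose y s : S^o := \sum_(a <- As | Q a && (s \subset msupport a))
   B a (msupport a :\: s) *: 'X_[a - mset s].
have yE s a : s \subset msupport a -> (y s : S)@_(a - mset s) =
    if (a \in As) && Q a then B a (msupport a :\: s) else 0.
  move=> sa; rewrite /y raddf_sum /=.
  under eq_bigr do rewrite mcoeffZ mcoeffX.
  have km a' : s \subset msupport a' -> ((a' - mset s)%MM == (a - mset s)%MM) = (a' == a).
    move=> sa'; apply/eqP/eqP => [E|->//].
    by rewrite -(submK (m := mset s) (m' := a')) ?mset_le // E submK ?mset_le.
  case: (boolP (a \in As)) => aAs /=; last first.
    rewrite big_seq_cond big1 // => a' /and3P[aA' _ sa']; rewrite km //.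
    by rewrite (negPf (_ : a' != a)) ?mulr0 //; apply: contraNneq aAs => <-.
  rewrite big_mkcond (bigD1_seq a) ?undup_uniq //= sa andbT eqxx mulr1 big1 ?addr0 //.
  move=> a' /negPf a'a; case: ifP => // /andP[_ sa'].
  by rewrite km // a'a mulr0.
exists y => s sk m Dm; rewrite mcoeffB mcoeff_mfilter.
have [a aE] : exists a, a = (m + mset s)%MM by eexists.
have mE : m = (a - mset s)%MM by rewrite aE addmK.
have sa : s \subset msupport a by rewrite -mset_le aE lem_addl.
have ka : (k <= #|msupport a|)%N by rewrite -sk subset_leq_card.
rewrite mE msupport_sub // in Dm; rewrite -aE mE mcoeff_kosz //.
have -> : \sum_(v in msupport a :\: s) std_sign K v s * (y (v |: s) : S)@_(a - mset (v |: s)) =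
    if (a \in As) && Q a then cobd (e a) (B a) (msupport a :\: s) else 0.
  rewrite /cobd; case: ifP => cond.
    apply: eq_bigr => v; rewrite inE => /andP[vs va]; rewrite yE ?cond; last first.
      by rewrite subUset sub1set va.
    by rewrite eE ?subsetDl // sub_setDK // setDU1.
  rewrite big1 // => v; rewrite inE => /andP[vs va]; rewrite yE ?cond ?mulr0 //.
  by rewrite subUset sub1set va.
case: (boolP (Q a)) => Qa; last by rewrite andbF subrr.
rewrite andbT; case: ifP => [_|aAs].
  rewrite -BP //.
  - by rewrite /c sub_setDK // subrr.
  - by rewrite /degree_faces /= subsetDl.
  - by rewrite cardsD (setIidPr sa) sk.
rewrite subr0; apply/eqP; apply: contraFT aAs => /memAs.
by rewrite submK // mset_le.
Qed.

End Koszul.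

(** * Homogeneous components and Koszul homology of monomial quotients *)

Section Filter.
Variables (K : fieldType) (n : nat).
Local Notation S := {mpoly K[n]}.
Implicit Types (m a : 'X_{1..n}) (p q : S) (P Q : pred 'X_{1..n}).

Lemma mfilterB P p q : mfilter P (p - q) = mfilter P p - mfilter P q.
Proof.
by apply/mpolyP => m; rewrite !(mcoeffB, mcoeff_mfilter); case: ifP; rewrite ?subr0.
Qed.

Lemma mfilter_sum P (I : Type) (r : seq I) (A : pred I) (F : I -> S) :
  mfilter P (\sum_(i <- r | A i) F i) = \sum_(i <- r | A i) mfilter P (F i).
Proof.
apply/mpolyP => m; rewrite mcoeff_mfilter !raddf_sum /=; case: ifP => Pm.
  by apply: eq_bigr => i _; rewrite mcoeff_mfilter Pm.
by rewrite big1 // => i _; rewrite mcoeff_mfilter Pm.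
Qed.

Lemma eq_mfilter P Q p : P =1 Q -> mfilter P p = mfilter Q p.
Proof. by move=> PQ; apply/mpolyP => m; rewrite !mcoeff_mfilter PQ. Qed.

Lemma mfilter_mul P Q p q :
    (forall m1 m2, m2 \in msupp q -> P (m1 + m2)%MM = Q m1) ->
  mfilter P (p * q) = mfilter Q p * q.
Proof.
move=> PQ; rewrite [in LHS](mpolyE q) [in RHS](mpolyE q) !mulr_sumr mfilter_sum.
rewrite big_seq [RHS]big_seq; apply: eq_bigr => m2 m2q; apply/mpolyP => m.
rewrite mcoeff_mfilter -!scalerAr !mcoeffZ !mcoeff_mulX mcoeff_mfilter.
case: ifP => Pm; case: ifP => le; rewrite ?mulr0 //.
  by rewrite -(PQ _ m2) // submK // Pm.
by rewrite -(PQ _ m2) // submK // Pm mulr0.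
Qed.

Lemma mdeg_mset (s : {set 'I_n}) : mdeg (mset s) = #|s|.
Proof.
rewrite mdegE -sum1_card [RHS]big_mkcond; apply: eq_bigr => i _.
by rewrite mnmE; case: (i \in s).
Qed.

Lemma msupport_mset (s : {set 'I_n}) : msupport (mset s) = s.
Proof. by apply/setP=> i; rewrite !inE mnmE; case: (i \in s). Qed.

End Filter.

Section Exact.
Variables (K : fieldType) (n : nat).
Local Notation S := {mpoly K[n]}.
Implicit Types (s t W : {set 'I_n}) (m a : 'X_{1..n}) (p q : S) (D : pred {set 'I_n}).

(** Only squarefree degrees contribute: a variable of exponent at least 2 is in the
    support whether or not it is taken into [s]. *)
Lemma degree_faces_cone D a x r : (1 < a x)%N -> acyclic K (degree_faces D a) r.
Proof.
move=> ax; apply: (acyclic_cone (x := x)) => t /andP[ta Dt]; apply/andP; split.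
  by rewrite subUset sub1set ta andbT inE; lia.
suff -> : x |: t :|: [set i | 1 < a i]%N = t :|: [set i | 1 < a i]%N by [].
by rewrite -setUA; apply/setUidPr; rewrite sub1set !inE ax orbT.
Qed.

Lemma degree_simplex_acyclic a x r : x \in msupport a ->
  acyclic K (degree_faces xpredT a) r.
Proof.
move=> xa; apply: (acyclic_cone (x := x)) => t /andP[ta _]; apply/andP; split=> //.
by rewrite subUset sub1set xa.
Qed.

Lemma degree_faces_squarefree D a : (forall i, a i <= 1)%N ->
  degree_faces D a =1 [pred t : {set 'I_n} | (t \subset msupport a) && D t].
Proof.
move=> a1 t; rewrite /degree_faces /=.
suff -> : [set i | 1 < a i]%N = set0 by rewrite setU0.
by apply/setP=> i; rewrite !inE ltnNge a1.
Qed.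

(** The Koszul complex of the polynomial ring is a resolution of [K]: this is the
    case of the zero ideal, where every multidegree other than 0 gives a simplex. *)
Lemma kosz_exact k (w : {set 'I_n} -> S^o) :
    (forall s, #|s|.+1 = k -> kosz w s = 0) ->
    (k = 0%N -> (w set0 : S)@_0%MM = 0) ->
  exists y : {set 'I_n} -> S^o, forall s, #|s| = k -> w s = kosz y s.
Proof.
move=> cyc w0.
have [|s sk|y yP] := @koszul_bounds K n xpredT (fun a => a != 0%MM) k w.
- move=> a a0 _; have /existsP[x xa] : [exists x, a x != 0%N].
    apply: contraR a0; rewrite negb_exists => /forallP a0; apply/eqP/mnmP => i.
    by rewrite mnm0E; apply/eqP; have := a0 i; rewrite negbK.
  by apply: (degree_simplex_acyclic (x := x)); rewrite inE.
- by move=> m _; rewrite cyc // mcoeff0.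
exists y => s sk; apply/eqP; rewrite -subr_eq0; apply/eqP/mpolyP => m.
rewrite mcoeff0 -[RHS](yP s sk m isT) !mcoeffB mcoeff_mfilter.
congr (_ - _); case: ifP => // /negbFE; rewrite mnmD_eq0 => /andP[/eqP-> /eqP s0].
have sE : s = set0 by rewrite -(msupport_mset s) s0; apply/setP=> i; rewrite !inE mnm0E.
by rewrite sE; apply: w0; rewrite -sk sE cards0.
Qed.

Lemma kosz_row r (w : {set 'I_n} -> 'rV[S]_r) s l :
  (kosz w s) 0 l = kosz (fun t => w t 0 l : S^o) s.
Proof. by rewrite /kosz summxE; apply: eq_bigr => v _; rewrite mxE. Qed.

Lemma kosz_exact_row r k (w : {set 'I_n} -> 'rV[S]_r) :
    (forall s, #|s|.+1 = k -> kosz w s = 0) ->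
    (k = 0%N -> forall l, (w set0 0 l)@_0%MM = 0) ->
  exists y : {set 'I_n} -> 'rV[S]_r, forall s, #|s| = k -> w s = kosz y s.
Proof.
move=> cyc w0; have /prop_choice[y yP] : forall l, exists y : {set 'I_n} -> S^o,
    forall s, #|s| = k -> (w s 0 l : S^o) = kosz y s.
  move=> l; apply: kosz_exact => [s sk|k0]; first by rewrite -kosz_row cyc // mxE.
  exact: w0.
exists (fun s => \row_l y l s) => s sk; apply/rowP => l; rewrite kosz_row yP //.
by apply: eq_bigr => v _; rewrite mxE.
Qed.

(** The degree [j] part of [Tor_k(S/I, K)] vanishes, in terms of Koszul cycles. *)
Definition tor_ideal (I : S -> Prop) k j : Prop :=
  forall w : {set 'I_n} -> S^o, (forall s, #|s|.+1 = k -> I (kosz w s)) ->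
  exists y : {set 'I_n} -> S^o, forall s, #|s| = k ->
    I (mfilter (fun m => mdeg m + #|s| == j)%N (w s) - kosz y s).

(** One half of Hochster's formula. *)
Lemma tor_ideal_of_acyclic D k j :
    (forall W, #|W| = j -> (k <= j)%N ->
       acyclic K [pred t : {set 'I_n} | (t \subset W) && D t] (j - k)) ->
  tor_ideal (sr_ideal D) k j.
Proof.
move=> ac w cyc.
have [|//|y yP] := @koszul_bounds K n D (fun a => mdeg a == j) k w.
  move=> a /eqP aj ka.
  have [/existsP[x ax]|a1] := boolP [exists x, 1 < a x]%N.
    exact: degree_faces_cone ax.
  have {}a1 i : (a i <= 1)%N by move: a1; rewrite negb_exists => /forallP/(_ i); rewrite -leqNgt.
  have cj : #|msupport a| = j.
    rewrite -aj -mdeg_mset; congr mdeg; apply/mnmP => i; rewrite mnmE inE.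
    by case: (a i) (a1 i) => [|[|]].
  apply/(eq_acyclic _ _ (degree_faces_squarefree D a1)); rewrite cj; apply: ac => //.
  by rewrite -cj.
exists y => s sk; have := yP s sk; congr (sr_ideal D (_ - _)); apply: eq_mfilter => m.
by rewrite mdegD mdeg_mset.
Qed.

(** The other half: a cochain [c] of the restriction to [W] is a Koszul chain of
    multidegree [mset W]. *)
Lemma acyclic_of_tor_ideal D k j W : down_closed D ->
    tor_ideal (sr_ideal D) k j -> #|W| = j -> (k <= j)%N ->
  acyclic K [pred t : {set 'I_n} | (t \subset W) && D t] (j - k).
Proof.
move=> Dd tor Wj kj.
pose e v t := std_sign K v W * std_sign K v t.
have he : sign_system e.
  by apply: sign_system_scale (std_sign_system K _) => v; apply: std_sign_sq.
have eE v t : t \subset W -> e v t = std_sign K v (W :\: t).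
  by move=> ta; rewrite std_sign_setD.
apply/(acyclic_signP _ _ he) => c cz.
pose w s : S^o := if (s \subset W) && (#|s| == k) then c (W :\: s) *: 'X_[mset (W :\: s)] else 0.
have msW : msupport (mset W) = W := msupport_mset W.
have msD s : s \subset W -> (mset W - mset s)%MM = mset (W :\: s).
  move=> sW; apply/mnmP => i; rewrite mnmBE !mnmE inE.
  by case: (boolP (i \in s)) => [/(subsetP sW)->|_] /=; rewrite ?subn0.
have [|y yP] := tor w.
  move=> s sk m Dm.
  case: (boolP (s \subset W)) => sW; last first.
    rewrite /kosz raddf_sum /= big1 // => v _.
    by rewrite /w subUset (negPf sW) andbF scaler0 mcoeff0.
  case: (eqVneq m (mset (W :\: s))) => [mE|mN].
    rewrite mE -msD // mcoeff_kosz ?msW //.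
    rewrite -[RHS](cz (W :\: s)); first last.
    - by rewrite cardsD (setIidPr sW) Wj; lia.
    - by rewrite /= subsetDl; move: Dm; rewrite mE msupport_mset.
    apply: eq_bigr => v; rewrite inE => /andP[vs vW].
    have vsW : v |: s \subset W by rewrite subUset sub1set vW.
    rewrite /w vsW cardsU1 vs add1n sk eqxx mcoeffZ mcoeffX -msD // eqxx mulr1.
    by rewrite eE ?subsetDl // sub_setDK // setDU1.
  rewrite /kosz raddf_sum /= big1 // => v; rewrite inE => vs.
  rewrite /w; case: ifP => [/andP[vsW _]|_]; last by rewrite scaler0 mcoeff0.
  rewrite -[X in X@__]/((std_sign K v s *: 'X_v) *
    (c (W :\: (v |: s)) *: 'X_[mset (W :\: (v |: s))]) : S).
  rewrite -scalerAl -scalerAr !mcoeffZ -mpolyXD mcoeffX -msD // mset_U1 // msD; last first.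
    by apply: subset_trans vsW; apply: subsetUr.
  rewrite addmC submK; first by rewrite eq_sym (negPf mN) !mulr0.
  apply/mnm_lepP => i; rewrite !mnmE inE; case: eqP => // <-.
  by rewrite vs (subsetP vsW) ?setU11.
exists (fun t => (y (W :\: t) : S)@_(mset t)) => t /andP[tW Dt] tk.
pose s := W :\: t; have sW : s \subset W by apply: subsetDl.
have sk : #|s| = k by rewrite cardsD (setIidPr tW) Wj tk; lia.
have ts : W :\: s = t by rewrite sub_setDK.
have := yP s sk (mset t); rewrite msupport_mset => /(_ Dt).
rewrite mcoeffB mcoeff_mfilter mdeg_mset tk sk subnK // eqxx.
rewrite /w sW sk eqxx ts mcoeffZ mcoeffX eqxx mulr1 => /eqP; rewrite subr_eq0 => /eqP->.
have tE : mset t = (mset W - mset s)%MM by rewrite msD // ts.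
rewrite tE mcoeff_kosz ?msW // ts; apply: eq_bigr => v vt.
rewrite eE // -/s setDD1 // msD; last first.
  by rewrite subUset sub1set sW (subsetP tW).
by rewrite -setDD1 // sub_setDK //; apply: subset_trans tW; apply: subsetDl.
Qed.

End Exact.

(** * Dimension shifting *)

Section Tor.
Variables (K : fieldType) (n : nat).
Local Notation S := {mpoly K[n]}.
Implicit Types (s t W : {set 'I_n}) (m a : 'X_{1..n}) (p : S) (D : pred {set 'I_n}).

(** The component of total degree [j] of the coefficient of an exterior product of
    [q] basis vectors, when the [l]-th generator has degree [deg l]. *)
Definition gpart r (deg : 'I_r -> nat) j q (u : 'rV[S]_r) : 'rV[S]_r :=
  \row_l mfilter (fun m => mdeg m + deg l + q == j)%N (u 0 l).

Definition graded_mx r' r (deg' : 'I_r' -> nat) (deg : 'I_r -> nat) (A : 'M[S]_(r', r)) : Prop :=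
  forall k l m, m \in msupp (A k l) -> (mdeg m + deg l)%N = deg' k.

(** [Z] is contained in the product of the maximal homogeneous ideal with [S^r]. *)
Definition no_constants r (Z : 'rV[S]_r -> Prop) : Prop :=
  forall u, Z u -> forall l, (u 0 l)@_0%MM = 0.

(** The degree [j] part of [Tor_k(S^r/Z, K)] vanishes, where the generators of [S^r]
    have degrees [deg]. *)
Definition tor_vanish r deg (Z : 'rV[S]_r -> Prop) k j : Prop :=
  forall w : {set 'I_n} -> 'rV[S]_r, (forall s, #|s|.+1 = k -> Z (kosz w s)) ->
  exists y : {set 'I_n} -> 'rV[S]_r, forall s, #|s| = k ->
    Z (gpart deg j #|s| (w s) - kosz y s).

Lemma gpart0 r (deg : 'I_r -> nat) j q : gpart deg j q 0 = 0.
Proof.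
apply/rowP=> l; rewrite !mxE; apply/mpolyP => m.
by rewrite mcoeff_mfilter mcoeff0 if_same.
Qed.

Lemma gpart_sum r (deg : 'I_r -> nat) j q (I : finType) (P : {pred I}) (F : I -> 'rV[S]_r) :
  gpart deg j q (\sum_(i in P) F i) = \sum_(i in P) gpart deg j q (F i).
Proof.
by apply/rowP=> l; rewrite mxE !summxE mfilter_sum; apply: eq_bigr => i _; rewrite mxE.
Qed.

Lemma gpartX r (deg : 'I_r -> nat) j q (c : K) v (u : 'rV[S]_r) :
  gpart deg j q ((c *: 'X_v) *: u) = (c *: 'X_v) *: gpart deg j q.+1 u.
Proof.
apply/rowP=> l; rewrite !mxE mulrC [RHS]mulrC; apply: mfilter_mul => m1 m2.
by move=> /msuppZ_le; rewrite msuppX inE => /eqP->; rewrite mdegD mdeg1 addn1 !addSn addnS.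
Qed.

Lemma gpart_kosz r (deg : 'I_r -> nat) j w s :
  gpart deg j #|s| (kosz w s) = kosz (fun t => gpart deg j #|t| (w t)) s.
Proof.
rewrite /kosz gpart_sum; apply: eq_bigr => v; rewrite inE => vs.
by rewrite gpartX cardsU1 vs.
Qed.

Lemma gpart_mul r' r (deg' : 'I_r' -> nat) (deg : 'I_r -> nat) (A : 'M[S]_(r', r)) j q u :
  graded_mx deg' deg A -> gpart deg j q (u *m A) = gpart deg' j q u *m A.
Proof.
move=> gA; apply/rowP=> l; rewrite !mxE mfilter_sum; apply: eq_bigr => k _; rewrite mxE.
apply: mfilter_mul => m1 m2 /gA; rewrite mdegD => <-; congr (_ == _); lia.
Qed.

Lemma kosz_mul r' r (A : 'M[S]_(r', r)) (w : {set 'I_n} -> 'rV[S]_r') s :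
  kosz w s *m A = kosz (fun t => w t *m A) s.
Proof. by rewrite /kosz mulmx_suml; apply: eq_bigr => v _; rewrite scalemxAl. Qed.

Section Shift.
Variables (r' r : nat) (deg' : 'I_r' -> nat) (deg : 'I_r -> nat) (A : 'M[S]_(r', r)).
Variables (Z : 'rV[S]_r -> Prop) (Z' : 'rV[S]_r' -> Prop).
Hypothesis ZE : forall u, Z u <-> exists w, u = w *m A.
Hypothesis Z'E : forall u, Z' u <-> u *m A = 0.
Hypothesis gA : graded_mx deg' deg A.

(** This lemma and the next are the connecting isomorphism between
    [Tor_(k+1)(S^r/Z, K)] and [Tor_k(S^r'/Z', K)] for a presentation of [Z] with kernel
    [Z'].  For [k = 0] it is an isomorphism only if [Z] contains no generator of [S^r]. *)
Lemma tor_shift_syzygy k j : no_constants Z ->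
  tor_vanish deg Z k.+1 j -> tor_vanish deg' Z' k j.
Proof.
move=> Zm tor w cyc.
have [| |v vP] := @kosz_exact_row K n r k (fun s => w s *m A).
- by move=> s sk; rewrite -kosz_mul; apply/Z'E/cyc.
- by move=> _; apply: Zm; apply/ZE; eexists.
have [|y yP] := tor v.
  by move=> s [sk]; apply/ZE; exists (w s); rewrite vP.
have /prop_choice[t tP] : forall s, exists t : 'rV_r', #|s| = k.+1 ->
    gpart deg j #|s| (v s) - kosz y s = t *m A.
  move=> s; case: (eqVneq #|s| k.+1) => [sk|/eqP sk]; last by exists 0.
  by have [t tE] := (ZE _).1 (yP s sk); exists t.
exists t => s sk; apply/Z'E; rewrite mulmxBl -(gpart_mul _ _ _ gA) vP // gpart_kosz kosz_mul.
rewrite -koszB (eq_kosz (w' := kosz y)) ?kosz_kosz // => s' s'k.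
by rewrite -tP -?sk // subKr.
Qed.

Lemma tor_shift_cosyzygy k j : tor_vanish deg' Z' k j -> tor_vanish deg Z k.+1 j.
Proof.
move=> tor v cyc.
have /prop_choice[w wP] : forall s, exists w, #|s| = k -> kosz v s = w *m A.
  move=> s; case: (eqVneq #|s| k) => [sk|/eqP sk]; last by exists 0.
  by have [w wE] := (ZE _).1 (cyc s (congr1 succn sk)); exists w.
have [|y yP] := tor w.
  move=> s sk; apply/Z'E; rewrite kosz_mul.
  rewrite (eq_kosz (w' := kosz v)) ?kosz_kosz // => s' s's.
  by rewrite wP // s's.
have [|//|t tP] := @kosz_exact_row K n r k.+1 (fun s => gpart deg j #|s| (v s) - y s *m A).
  move=> s [sk]; rewrite koszB -gpart_kosz wP // -kosz_mul (gpart_mul _ _ _ gA) -mulmxBl.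
  by apply/Z'E; apply: yP.
exists t => s sk; rewrite -tP //; apply/ZE; exists (y s); by rewrite subKr.
Qed.

End Shift.

Lemma mcoeff0_kosz (w : {set 'I_n} -> S^o) s : (kosz w s : S)@_0%MM = 0.
Proof.
rewrite /kosz raddf_sum /= big1 // => v _.
rewrite -[X in X@__]/((std_sign K v s *: 'X_v) * (w (v |: s) : S)).
by rewrite rmorphM /= mcoeffZ mcoeffX mnm1_eq0 mulr0 mul0r.
Qed.

(** [Tor_0(S^r/Z, K)] is [K^r], with one basis vector in the degree of each
    generator. *)
Lemma tor_vanish0 r (deg : 'I_r -> nat) (Z : 'rV[S]_r -> Prop) j : Z 0 -> no_constants Z ->
  tor_vanish deg Z 0 j <-> forall l, deg l <> j.
Proof.
move=> Z0 Zm; split=> [tor l lj|degN w _].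
  have [//|y yP] := tor (fun=> delta_mx 0 l).
  have := Zm _ (yP set0 (cards0 _)) l; rewrite cards0 !mxE mcoeffB mcoeff_mfilter !eqxx.
  rewrite mdeg0 add0n addn0 lj eqxx mcoeff1 eqxx kosz_row mcoeff0_kosz subr0.
  by move/eqP; rewrite oner_eq0.
have [//|_ l|y yP] := @kosz_exact_row K n r 0 (fun s => gpart deg j #|s| (w s)).
  rewrite !mxE mcoeff_mfilter cards0 addn0 mdeg0 add0n.
  by case: eqP => // /degN.
by exists y => s s0; rewrite yP // subrr.
Qed.

Lemma sr_idealD D p1 p2 : sr_ideal D p1 -> sr_ideal D p2 -> sr_ideal D (p1 + p2).
Proof. by move=> h1 h2 m Dm; rewrite mcoeffD h1 ?h2 ?addr0. Qed.

Lemma sr_ideal0 D : sr_ideal D (0 : S).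
Proof. by move=> m _; rewrite mcoeff0. Qed.

Lemma sr_idealM D p1 p2 : down_closed D -> sr_ideal D p2 -> sr_ideal D (p1 * p2).
Proof.
move=> Dd h m Dm; rewrite mcoeffM big1 // => k /eqP mE; rewrite [X in _ * X]h ?mulr0 //.
apply: Dd Dm; apply/subsetP=> i; rewrite !inE.
by have /mnmP/(_ i) := mE; rewrite mnmDE => ->; rewrite addn_eq0 negb_and orbC => ->.
Qed.

Lemma sr_idealN D p : sr_ideal D p -> sr_ideal D (- p).
Proof. by move=> h m Dm; rewrite mcoeffN h ?oppr0. Qed.

Lemma sr_ideal_congr D p1 p2 : sr_ideal D (p1 - p2) -> sr_ideal D p2 -> sr_ideal D p1.
Proof. by move=> h1 h2; rewrite -(subrK p2 p1); apply: sr_idealD. Qed.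

Lemma sr_ideal_filter D (P : pred 'X_{1..n}) p : sr_ideal D p -> sr_ideal D (mfilter P p).
Proof. by move=> h m Dm; rewrite mcoeff_mfilter h // if_same. Qed.

Lemma sr_ideal_kosz D (w : {set 'I_n} -> S^o) s : down_closed D ->
  (forall t, #|t| = #|s|.+1 -> sr_ideal D (w t)) -> sr_ideal D (kosz w s).
Proof.
move=> Dd h; rewrite /kosz; apply: (big_ind (fun p => sr_ideal D p)).
- exact: sr_ideal0.
- exact: sr_idealD.
- move=> v; rewrite inE => vs; apply: sr_idealM => //; apply: h; by rewrite cardsU1 vs.
Qed.

Section Augmentation.
Variables (r : nat) (deg : 'I_r -> nat) (aug : 'cV[S]_r) (D : pred {set 'I_n}).
Hypothesis Dd : down_closed D.
Hypothesis gaug : forall (k : 'I_r) m, m \in msupp (aug k ord0) -> mdeg m = deg k.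
Hypothesis aug_surj : forall p : S, exists u : 'rV_r, sr_ideal D (p - (u *m aug) ord0 ord0).
Let ev (u : 'rV[S]_r) : S^o := (u *m aug) ord0 ord0.

Lemma aug_filter j q u :
  mfilter (fun m => mdeg m + q == j)%N (ev u) = ev (gpart deg j q u).
Proof.
have gA : graded_mx deg (fun _ : 'I_1 => 0%N) aug.
  by move=> k l m; rewrite (ord1 l) addn0; apply: gaug.
rewrite /ev -(gpart_mul _ _ _ gA) [RHS]mxE; apply: eq_mfilter => m; by rewrite addn0.
Qed.

Lemma aug_kosz w s : ev (kosz w s) = kosz (fun t => ev (w t)) s.
Proof. by rewrite /ev kosz_mul kosz_row. Qed.

Lemma augB u u' : ev (u - u') = ev u - ev u'.
Proof. by rewrite /ev mulmxBl mxE [X in _ + X = _]mxE. Qed.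

(** Both sides speak of the same module [S/I], presented once as a quotient of the
    first free module of a resolution. *)
Lemma tor_augmentation k j :
  tor_vanish deg (fun u => sr_ideal D (ev u)) k j <-> tor_ideal (sr_ideal D : S -> Prop) k j.
Proof.
have /prop_choice[lift liftP] := aug_surj.
split=> [tor w cyc|tor w cyc].
  have [|y yP] := tor (fun s => lift (w s)).
    move=> s sk; rewrite aug_kosz.
    apply: sr_ideal_congr (cyc s sk).
    suff: sr_ideal D (kosz (fun t => ev (lift (w t)) - w t) s) by rewrite koszB.
    by apply: sr_ideal_kosz => // t _; rewrite -opprB; apply: sr_idealN; apply: liftP.
  exists (fun s => ev (y s)) => s sk.
  apply: sr_ideal_congr (_ : sr_ideal D
    (mfilter (fun m => mdeg m + #|s| == j)%N (ev (lift (w s))) - kosz (fun s => ev (y s)) s)).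
    by rewrite opprB addrA subrK -mfilterB; apply: sr_ideal_filter; apply: liftP.
  by rewrite aug_filter -aug_kosz -augB; apply: yP.
have [|y yP] := tor (fun s => ev (w s)).
  by move=> s sk; rewrite -aug_kosz; apply: cyc.
exists (fun s => lift (y s)) => s sk.
rewrite augB -aug_filter aug_kosz; apply: sr_ideal_congr (yP s sk).
rewrite opprB addrC subrKA.
suff: sr_ideal D (kosz (fun t => y t - ev (lift (y t))) s) by rewrite koszB.
by apply: sr_ideal_kosz => // t _; apply: liftP.
Qed.

End Augmentation.

End Tor.

(** * Betti numbers of minimal resolutions *)

Section Criterion.
Variables (K : fieldType) (n : nat) (D : pred {set 'I_n}).
Local Notation S := {mpoly K[n]}.
Hypothesis Dd : down_closed D.

(** The submodule by which the [i]-th free module is divided to obtain the [i]-th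
    syzygy module of [S/I]. *)
Definition syzygies (F : free_seq K n) (i : nat) : 'rV[S]_(frank F i) -> Prop :=
  if i is i'.+1 return 'rV[S]_(frank F i) -> Prop then fun u => u *m fdiff F i' = 0
  else fun u => sr_ideal D ((u *m faug F) ord0 ord0).

Lemma no_constants_image r' r (A : 'M[S]_(r', r)) :
  (forall k l, (A k l)@_0%MM = 0) -> no_constants (fun u : 'rV[S]_r => exists w, u = w *m A).
Proof.
move=> A0 u [w ->] l; rewrite mxE raddf_sum /= big1 // => k _.
by rewrite rmorphM /= A0 mulr0.
Qed.

(** Shifting dimensions [i] times turns [Tor_i(S/I, K)] into [Tor_0] of the [i]-th
    syzygy module, which minimality identifies with the generators of [F_i]. *)
Lemma fdeg_tor (F : free_seq K n) i j : minimal_resolution (sr_ideal D) F ->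
  tor_ideal (sr_ideal D : S -> Prop) i j <-> forall k : 'I_(frank F i), fdeg k <> j.
Proof.
move=> [[gF gaug] [surj ex0 ex] minF].
have syzE p u : syzygies (i := p) u <-> exists w, u = w *m fdiff F p.
  by case: p u => [|p] u; [apply: ex0|apply: ex].
have syz0 p : no_constants (@syzygies F p).
  move=> u /syzE; apply: no_constants_image; exact: minF.
have shift p k : tor_vanish (@fdeg _ _ F 0) (@syzygies F 0) (k + p) j <->
                 tor_vanish (@fdeg _ _ F p) (@syzygies F p) k j.
  elim: p k => [|p IH] k; first by rewrite addn0.
  rewrite addnS -addSn IH; split.
    by apply: (tor_shift_syzygy (syzE p) (fun u => iff_refl (u *m fdiff F p = 0)) (gF p)).
  by apply: (tor_shift_cosyzygy (syzE p) (fun u => iff_refl (u *m fdiff F p = 0)) (gF p)).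
rewrite -(tor_augmentation Dd gaug surj i j) -[i in X in X <-> _]add0n.
rewrite (shift i 0%N); apply: tor_vanish0 => //.
by apply/syzE; exists 0; rewrite mul0mx.
Qed.

End Criterion.

(** * Minimal generators of syzygies *)

(** A finite subfamily of largest rank spans. *)
Lemma finite_span (K : fieldType) (N : nat) (X : Type) (A : X -> Prop) (cf : X -> 'rV[K]_N) :
  exists k (g : 'I_k -> X), (forall i, A (g i)) /\
    forall x, A x -> (cf x <= \matrix_(i < k) cf (g i))%MS.
Proof.
have ext d k (g : 'I_k -> X) : (forall i, A (g i)) ->
    (N <= \rank (\matrix_(i < k) cf (g i)) + d)%N ->
    exists k (g : 'I_k -> X), (forall i, A (g i)) /\
      forall x, A x -> (cf x <= \matrix_(i < k) cf (g i))%MS.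
  elim: d k g => [|d IH] k g Ag rk.
    exists k, g; split=> // x _; apply: submx_full.
    by rewrite /row_full eqn_leq rank_leq_col /= -[X in (_ <= X)%N]addn0.
  have [h|/not_all_ex_not[x nx]] :=
      classic (forall x, A x -> (cf x <= \matrix_(i < k) cf (g i))%MS).
    by exists k, g.
  have [Ax /negP xN] := imply_to_and _ _ nx.
  pose g' (i : 'I_k.+1) := if unlift ord0 i is Some j then g j else x.
  have Mx : (cf x <= \matrix_(i < k.+1) cf (g' i))%MS.
    by have := row_sub ord0 (\matrix_(i < k.+1) cf (g' i)); rewrite rowK /g' unlift_none.
  have MM : (\matrix_(i < k) cf (g i) <= \matrix_(i < k.+1) cf (g' i))%MS.
    apply/row_subP => i; rewrite rowK.
    by have := row_sub (lift ord0 i) (\matrix_(i < k.+1) cf (g' i)); rewrite rowK /g' liftK.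
  apply: (IH k.+1 g').
    by move=> i; rewrite /g'; case: unlift.
  suff lt : (\rank (\matrix_(i < k) cf (g i)) < \rank (\matrix_(i < k.+1) cf (g' i)))%N by lia.
  rewrite ltn_neqAle (mxrankS MM) andbT (mxrank_leqif_sup MM).
  by apply: contra xN => /(submx_trans Mx).
have g0 (i : 'I_0) : X by case: i.
by apply: (ext N 0%N g0) => [[]//|]; rewrite leq_addl.
Qed.

Section Generation.
Variables (K : fieldType) (n : nat).
Local Notation S := {mpoly K[n]}.
Implicit Types (m : 'X_{1..n}).

Lemma gpart_id r (deg : 'I_r -> nat) j q (u : 'rV[S]_r) :
  gpart deg j q (gpart deg j q u) = gpart deg j q u.
Proof.
apply/rowP => l; rewrite !mxE; apply/mpolyP => m; rewrite !mcoeff_mfilter. by case: (_ == j).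
Qed.

Lemma gpartS r (deg : 'I_r -> nat) j q (u : 'rV[S]_r) :
  gpart deg j.+1 q.+1 u = gpart deg j q u.
Proof. by apply/rowP => l; rewrite !mxE; apply: eq_mfilter => m; rewrite addnS eqSS. Qed.

Lemma sum_gpart r (deg : 'I_r -> nat) (u : 'rV[S]_r) :
  exists N, u = \sum_(j < N) gpart deg j 0 u.
Proof.
exists (\max_l (msize (u 0%R l) + deg l)%N); apply/rowP => l; rewrite summxE.
apply/mpolyP => m; rewrite raddf_sum /=.
under eq_bigr do rewrite mxE mcoeff_mfilter addn0.
case: (boolP (m \in msupp (u 0 l))) => mu; last first.
  by rewrite (memN_msupp_eq0 mu) big1 // => j _; rewrite if_same.
have lt : (mdeg m + deg l < \max_l (msize (u 0%R l) + deg l))%N.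
  apply: leq_trans (leq_bigmax l); rewrite ltn_add2r; exact: msize_mdeg_lt.
rewrite (bigD1 (Ordinal lt)) //= eqxx big1 ?addr0 // => j jN.
by rewrite eq_sym (negPf (_ : j != mdeg m + deg l :> nat)%N).
Qed.

Lemma degree_span r (deg : 'I_r -> nat) (Z : 'rV[S]_r -> Prop) d :
  exists k (g : 'I_k -> 'rV[S]_r),
    (forall i, Z (g i) /\ gpart deg d 0 (g i) = g i) /\
    forall u, Z u -> gpart deg d 0 u = u -> exists c : 'I_k -> K, u = \sum_i (c i)%:MP *: g i.
Proof.
pose T : finType := ('X_{1..n < d.+1} * 'I_r)%type.
pose Tx (x : 'I_#|T|) : 'X_{1..n < d.+1} * 'I_r := @enum_val T predT x.
pose cf (u : 'rV[S]_r) : 'rV[K]_#|T| := \row_(x < #|T|) (u 0 (Tx x).2)@_(Tx x).1.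
have [k [g [gP gS]]] := finite_span (fun u => Z u /\ gpart deg d 0 u = u) cf.
exists k, g; split=> // u Zu ud; have /submxP[c cE] := gS u (conj Zu ud).
exists (fun i => c 0 i); apply/rowP => l; rewrite summxE; apply/mpolyP => m.
rewrite raddf_sum /=.
under eq_bigr do rewrite mxE mcoeffCM.
have [md|md] := ltnP (mdeg m) d.+1; last first.
  have hom0 (v : 'rV[S]_r) : gpart deg d 0 v = v -> (v 0 l)@_m = 0.
    by move=> <-; rewrite mxE mcoeff_mfilter ifF //; apply/negbTE; lia.
  rewrite hom0 // big1 // => i _; rewrite hom0 ?mulr0 //; exact: (gP i).2.
have /rowP/(_ (enum_rank ((BMultinom md, l) : T))) := cE.
rewrite !mxE /Tx enum_rankK /= => ->; apply: eq_bigr => i _.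
by rewrite !mxE /Tx enum_rankK.
Qed.

(** The invariant kept while a resolution is built.  The last clause takes the place of
    the Hilbert basis theorem: it bounds the degrees of generators by [n] at every step. *)
Definition good_syzygies r (deg : 'I_r -> nat) (Z : 'rV[S]_r -> Prop) : Prop :=
  [/\ Z 0 /\ (forall u v, Z u -> Z v -> Z (u + v)),
      forall p u, Z u -> Z (p *: u),
      forall j u, Z u -> Z (gpart deg j 0 u),
      no_constants Z &
      forall k j, (n < j)%N -> tor_vanish deg Z k j].

Definition generates r (deg : 'I_r -> nat) (Z : 'rV[S]_r -> Prop)
    r' (deg' : 'I_r' -> nat) (A : 'M[S]_(r', r)) : Prop :=
  (forall k, Z (row k A) /\ gpart deg (deg' k) 0 (row k A) = row k A) /\
  (forall u, Z u -> exists w, u = w *m A).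

(** An element of [Z] of degree [j > n] is a Koszul boundary in [S^r]; as the degree [j]
    part of [Tor_1(S^r/Z, K)] vanishes, it is a combination, with coefficients the
    variables, of elements of [Z] of degree [j - 1].  So [Z] is generated in degrees at
    most [n], and each of these finitely many degrees has finite dimension. *)
Lemma exists_generators r (deg : 'I_r -> nat) (Z : 'rV[S]_r -> Prop) :
  good_syzygies deg Z -> exists r' deg' A, @generates r deg Z r' deg' A.
Proof.
move=> [[Z0 ZD] ZM Zg Zm Ztor].
have /prop_choice[gs gsP] : forall d, exists g : {k & 'I_k -> 'rV[S]_r},
    (forall i, Z (projT2 g i) /\ gpart deg d 0 (projT2 g i) = projT2 g i) /\
    forall u, Z u -> gpart deg d 0 u = u ->
      exists c, u = \sum_(i < projT1 g) (c i)%:MP *: projT2 g i.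
  by move=> d; have [k [g gP]] := degree_span deg Z d; exists (existT _ k g).
pose I : finType := {d : 'I_n.+1 & 'I_(projT1 (gs d))}.
pose gen (x : I) := projT2 (gs (tag x)) (tagged x).
(* The rows of [A] span the components of [Z] of degree at most [n] over [K]. *)
pose A := \matrix_(i < #|I|) gen (enum_val i).
pose T (u : 'rV[S]_r) := exists w, u = w *m A.
have T0 : T 0 by exists 0; rewrite mul0mx.
have TD u v : T u -> T v -> T (u + v).
  by move=> [w ->] [w' ->]; exists (w + w'); rewrite mulmxDl.
have TM p u : T u -> T (p *: u) by move=> [w ->]; exists (p *: w); rewrite scalemxAl.
have Tsum (J : finType) (P : {pred J}) (F : J -> 'rV[S]_r) :
    (forall i, P i -> T (F i)) -> T (\sum_(i in P) F i).
  by move=> h; apply: (big_ind T).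
have Tgen x : T (gen x).
  by exists (delta_mx 0 (enum_rank x)); rewrite -rowE rowK enum_rankK.
have step j : forall u, Z u -> T (gpart deg j 0 u).
  elim/ltn_ind: j => j IH u Zu; have [jn|jn] := leqP j n.
    have Zj := Zg j u Zu.
    have [c ->] := (gsP j).2 _ Zj (gpart_id _ _ _ _).
    apply: Tsum => i _; apply: TM; have jn' : (j < n.+1)%N by [].
    exact: (Tgen (Tagged (fun d : 'I_n.+1 => 'I_(projT1 (gs d)))
      (i : 'I_(projT1 (gs (Ordinal jn')))))).
  have [|_|y yE] := @kosz_exact_row K n r 0 (fun=> u); [by []|exact: Zm|].
  have [|x xP] := Ztor 1%N j jn y.
    by move=> s [/cards0_eq->]; rewrite -yE ?cards0.
  pose z (s : {set 'I_n}) := gpart deg j #|s| (y s) - kosz x s.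
  have -> : gpart deg j 0 u = kosz (fun s => gpart deg j #|s| (z s)) set0.
    rewrite -gpart_kosz cards0 /z koszB kosz_kosz subr0 -gpart_kosz cards0.
    by rewrite gpart_id (yE set0) ?cards0.
  apply: Tsum => v _; apply: TM; rewrite setU0 cards1.
  case: j jn IH xP @z => [//|j] jn IH xP z; rewrite gpartS.
  by apply: IH => //; apply: xP; rewrite cards1.
pose dg (x : I) : nat := tag x.
exists #|I|, (fun i : 'I_#|I| => dg (enum_val i)), A; split.
  by move=> i; rewrite rowK; apply: (gsP _).1.
move=> u Zu; have [N uE] := sum_gpart deg u; rewrite uE.
by apply: Tsum => j _; apply: step.
Qed.

Lemma mulmx_col'_row' r' r (w : 'rV[S]_r'.+1) (A : 'M[S]_(r'.+1, r)) k :
  w 0 k = 0 -> w *m A = col' k w *m row' k A.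
Proof.
move=> wk; apply/rowP => l; rewrite !mxE (bigD1 k) //= wk mul0r add0r.
rewrite (eq_bigl (mem (lift k @: [set: 'I_r']))); last first.
  move=> i; apply/idP/imsetP => [|[j _ ->]]; last by rewrite eq_sym neq_lift.
  by case: (unliftP k i) => [j ->|->]; [exists j|rewrite eqxx].
rewrite big_imset /=; last by move=> i j _ _; apply: lift_inj.
by apply: eq_big => [i|i _]; rewrite ?inE // !mxE.
Qed.

(** If a relation between the generators had a nonzero constant as [k]-th coefficient,
    its component of degree [deg' k] would express the [k]-th generator through the others,
    against the choice of the number of generators. *)
Lemma minimal_generators r (deg : 'I_r -> nat) (Z : 'rV[S]_r -> Prop) r' deg' A :
    good_syzygies deg Z -> @generates r deg Z r' deg' A ->
    (forall r1 deg1 A1, @generates r deg Z r1 deg1 A1 -> (r' <= r1)%N) ->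
  [/\ graded_mx deg' deg A, forall u, Z u <-> exists w, u = w *m A &
      good_syzygies deg' (fun u => u *m A = 0)].
Proof.
move=> [[Z0 ZD] ZM Zg Zm Ztor] [rowA gen] min.
have gA : graded_mx deg' deg A.
  move=> k l m; rewrite mcoeff_msupp; have /rowP/(_ l) := (rowA k).2.
  rewrite !mxE => <-; rewrite mcoeff_mfilter addn0.
  by case: ifP => [/eqP|_]; rewrite ?eqxx.
have ZE u : Z u <-> exists w, u = w *m A.
  split=> [|[w ->]]; first exact: gen.
  rewrite mulmx_sum_row; apply: (big_ind Z) => // k _; apply: ZM; exact: (rowA k).1.
split=> //; split.
- by split=> [|u v /= uA vA]; rewrite ?mul0mx // mulmxDl uA vA addr0.
- by move=> p u uA; rewrite -scalemxAl uA scaler0.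
- by move=> j u uA; rewrite -(gpart_mul _ _ _ gA) uA gpart0.
- move=> u uA k; apply/eqP; apply: contraT => uk.
  case: r' deg' A rowA gen min gA ZE u uA k uk => [|r1] deg' A rowA gen min gA ZE u uA k uk.
    by case: k {uk}.
  (* In the degree of the [k]-th generator, the [k]-th coefficient is a constant. *)
  pose u' := gpart deg' (deg' k) 0 u.
  have u'A : u' *m A = 0 by rewrite -(gpart_mul _ _ _ gA) uA gpart0.
  pose c := (u 0 k)@_0%MM.
  have u'k : u' 0 k = c%:MP.
    apply/mpolyP => m; rewrite mxE mcoeff_mfilter mcoeffC addn0 -[X in _ == X]add0n.
    rewrite eqn_add2r mdeg_eq0; case: eqP => [->|_]; by rewrite ?mulr1 ?mulr0.
  suff : (r1.+1 <= r1)%N by rewrite ltnn.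
  apply: (min r1 (fun i => deg' (lift k i)) (row' k A)); split.
    by move=> i; rewrite row_rowsub; have := rowA (lift k i).
  move=> v /gen[w ->]; pose w2 := w - (w 0 k * (c^-1)%:MP) *: u'.
  exists (col' k w2); rewrite -mulmx_col'_row'.
    by rewrite mulmxBl -scalemxAl u'A scaler0 subr0.
  rewrite mxE [X in _ + X]mxE [X in - X]mxE u'k -mulrA -mpolyCM mulVf //.
  by rewrite mulr1 subrr.
- by move=> k j nj; apply: (tor_shift_syzygy ZE (fun u => iff_refl _) gA Zm); apply: Ztor.
Qed.

End Generation.

(** * Existence of minimal resolutions *)

Section Existence.
Variables (K : fieldType) (n : nat).
Local Notation S := {mpoly K[n]}.

(** A free module of the resolution under construction, with the submodule that the
    next free module has to cover. *)
Record stage := Stage {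
  srank : nat;
  sdeg : 'I_srank -> nat;
  ssyz : 'rV[S]_srank -> Prop;
  sgood : good_syzygies sdeg ssyz }.

Lemma stage_step (st : stage) : exists p : {st' : stage & 'M[S]_(srank st', srank st)},
  [/\ graded_mx (@sdeg (projT1 p)) (@sdeg st) (projT2 p),
      forall u, ssyz (s := st) u <-> exists w, u = w *m projT2 p &
      forall u, ssyz (s := projT1 p) u <-> u *m projT2 p = 0].
Proof.
pose P r1 := exists deg1 A1, @generates K n _ (@sdeg st) (@ssyz st) r1 deg1 A1.
have [r0 r0P] : exists r, P r by have := exists_generators (sgood st).
have [r [[deg' [A genA]] rmin]] : exists r, P r /\ forall r1, P r1 -> (r <= r1)%N.
  elim/ltn_ind: r0 r0P => r0 IH r0P.
  have [[r1 [r1P lt]]|none] := classic (exists r1, P r1 /\ (r1 < r0)%N); first exact: IH lt r1P.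
  exists r0; split=> // r1 r1P; rewrite leqNgt; apply/negP => lt.
  by apply: none; exists r1.
have [|gA ZE good'] := minimal_generators (sgood st) genA.
  by move=> r1 deg1 A1 gen1; apply: rmin; exists deg1, A1.
by exists (existT _ (Stage good') A).
Qed.

Definition next_stage (st : stage) : {st' : stage & 'M[S]_(srank st', srank st)} :=
  proj1_sig (constructive_indefinite_description _ (stage_step st)).

Lemma next_stageP (st : stage) :
  [/\ graded_mx (@sdeg (projT1 (next_stage st))) (@sdeg st) (projT2 (next_stage st)),
      forall u, ssyz (s := st) u <-> exists w, u = w *m projT2 (next_stage st) &
      forall u, ssyz (s := projT1 (next_stage st)) u <-> u *m projT2 (next_stage st) = 0].
Proof. exact: (proj2_sig (constructive_indefinite_description _ (stage_step st))). Qed.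

Fixpoint stages (st : stage) i : stage :=
  if i is i'.+1 then projT1 (next_stage (stages st i')) else st.

Lemma mul_const1 (u : 'rV[S]_1) : (u *m (const_mx 1 : 'cV[S]_1)) ord0 ord0 = u 0 0.
Proof. by rewrite mxE big_ord1 mxE mulr1. Qed.

(** The first syzygies satisfy the invariant because Hochster's formula has no set [W]
    with more than [n] elements. *)
Lemma exists_minimal_resolution (D : pred {set 'I_n}) : down_closed D -> D set0 ->
  exists F : free_seq K n, minimal_resolution (sr_ideal D) F.
Proof.
move=> Dd D0; pose aug : 'cV[S]_1 := const_mx 1.
pose Z (u : 'rV[S]_1) := sr_ideal D ((u *m aug) ord0 ord0).
have gaug (k : 'I_1) m : m \in msupp (aug k ord0) -> mdeg m = 0%N.
  by rewrite mxE msupp1 inE => /eqP->; rewrite mdeg0.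
have surj (p : S) : exists u : 'rV_1, sr_ideal D (p - (u *m aug) ord0 ord0).
  by exists (const_mx p); rewrite mul_const1 mxE subrr; apply: sr_ideal0.
have good0 : good_syzygies (fun _ : 'I_1 => 0%N) Z.
  split.
  - split=> [|u v]; first by rewrite /Z mul0mx mxE; apply: sr_ideal0.
    by rewrite /Z mulmxDl [X in _ -> _ -> sr_ideal D X]mxE; apply: sr_idealD.
  - by move=> p u; rewrite /Z -scalemxAl [X in _ -> sr_ideal D X]mxE; apply: sr_idealM.
  - move=> j u Zu; have := aug_filter gaug j 0 u; rewrite /Z => <-.
    exact: sr_ideal_filter.
  - move=> u; rewrite /Z mul_const1 => Zu l; rewrite ord1; apply: Zu.
    by rewrite (_ : msupport 0 = set0) //; apply/setP=> i; rewrite !inE mnm0E.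
  - move=> k j nj; apply/(tor_augmentation Dd gaug surj); apply: tor_ideal_of_acyclic => W Wj.
    by have := max_card (mem W); rewrite Wj card_ord leqNgt nj.
pose st := stages (Stage good0).
pose F := @FreeSeq K n (fun i => srank (st i)) (fun i => @sdeg (st i))
  (fun i => projT2 (next_stage (st i))) aug.
have imE i u : ssyz (s := st i) u <-> exists w, u = w *m fdiff F i.
  by have [_ h _] := next_stageP (st i); apply: h.
have kerE i u : ssyz (s := st i.+1) u <-> u *m fdiff F i = 0.
  by have [_ _ h] := next_stageP (st i); apply: h.
exists F; split.
- split; last by move=> k m /gaug.
  by move=> i; have [h _ _] := next_stageP (st i); apply: h.
- split; first exact: surj.
    exact: (imE 0%N).
  by move=> i u; rewrite -kerE; apply: imE.
- move=> i k l; have [_ _ _ nc _] := sgood (st i).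
  have rowk : ssyz (s := st i) (row k (fdiff F i)).
    by apply/imE; exists (delta_mx 0 k); rewrite -rowE.
  by have := nc _ rowk l; rewrite mxE.
Qed.

End Existence.

(** * Edge ideals and regularity *)

Section IdealGen.
Variables (R : comNzRingType) (g : R -> Prop).

Lemma ideal_gen0 : ideal_gen g 0.
Proof. by exists [::] => //; rewrite big_nil. Qed.

Lemma ideal_genD p q : ideal_gen g p -> ideal_gen g q -> ideal_gen g (p + q).
Proof.
move=> [s sg ->] [t tg ->]; exists (s ++ t); last by rewrite big_cat.
by move=> c; rewrite mem_cat => /orP[/sg|/tg].
Qed.

Lemma ideal_gen_mul a b : g b -> ideal_gen g (a * b).
Proof.
move=> gb; exists [:: (a, b)]; last by rewrite big_seq1.
by move=> c; rewrite inE => /eqP->.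
Qed.

End IdealGen.

Section EdgeIdeal.
Variables (K : fieldType) (G : sgraph).
Local Notation n := #|G|.
Local Notation S := {mpoly K[n]}.

Definition vertex_of (i : 'I_n) : G := enum_val i.

(** Edge ideals live in a ring with variables numbered by ['I_#|G|]. *)
Definition index_face : pred {set 'I_n} := [pred t : {set 'I_n} | face (vertex_of @: t)].

Lemma vertex_of_rank v : vertex_of (enum_rank v) = v.
Proof. exact: enum_rankK. Qed.

Lemma vertex_of_inj : injective vertex_of.
Proof. exact: enum_val_inj. Qed.

Lemma face_down : down_closed (@face G).
Proof.
move=> s t st /andP[/independentP it /forall_inP nt]; apply/andP; split.
  by apply/independentP => u v us vs; apply: it; apply: (subsetP st).
by apply/forall_inP => v vs; apply: nt; apply: (subsetP st).
Qed.

Lemma face0 : face (set0 : {set G}).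
Proof.
apply/andP; split; first by apply/independentP => u v; rewrite inE.
by apply/forall_inP => v; rewrite inE.
Qed.

Lemma index_face_down : down_closed index_face.
Proof. by move=> s t st; apply: face_down; apply: imsetS. Qed.

Lemma index_face0 : index_face set0.
Proof. by rewrite /index_face /= imset0 face0. Qed.

Lemma edge_idealE : @edge_ideal K G = sr_ideal index_face.
Proof.
apply: functional_extensionality => p; apply: propositional_extensionality; split.
  case=> s sg ->; rewrite big_seq; apply: (big_ind (fun p => sr_ideal index_face p)).
  - exact: sr_ideal0.
  - exact: sr_idealD.
  - move=> c /sg gc; apply: (sr_idealM _ index_face_down) => m.
    case/andP=> /independentP ind /forall_inP iso.
    have in_supp v : m (enum_rank v) != 0%N -> v \in vertex_of @: msupport m.
      by move=> mv; apply/imsetP; exists (enum_rank v); rewrite ?inE ?vertex_of_rank.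
    case: gc => [[u [v [uv ->]]]|[v [vi ->]]].
      rewrite /vvar -mpolyXD mcoeffX; case: eqP => // mE.
      have mu : m (enum_rank u) != 0%N by rewrite -mE mnmDE !mnm1E eqxx.
      have mv : m (enum_rank v) != 0%N by rewrite -mE mnmDE !mnm1E eqxx addn1.
      by have := ind u v (in_supp u mu) (in_supp v mv); rewrite uv.
    rewrite /vvar mcoeffX; case: eqP => // mE.
    have mv : m (enum_rank v) != 0%N by rewrite -mE mnm1E eqxx.
    by have := iso v (in_supp v mv); rewrite vi.
move=> ip; rewrite (mpolyE p) big_seq; apply: (big_ind (edge_ideal (K := K) (G := G))).
- exact: ideal_gen0.
- exact: ideal_genD.
move=> m mp; have nf : ~~ index_face (msupport m).
  by apply/negP => /ip; apply/eqP; rewrite -mcoeff_msupp.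
have supp v : v \in vertex_of @: msupport m -> (U_(enum_rank v) <= m)%MM.
  case/imsetP => i; rewrite inE => mi ->; apply/mnm_lepP => k; rewrite mnm1E.
  rewrite /vertex_of enum_valK; case: eqP => // <-; by rewrite lt0n.
move: nf; rewrite /index_face /face /= negb_and => /orP[].
  rewrite negb_forall => /existsP[u]; rewrite negb_imply => /andP[/supp us].
  rewrite negb_forall => /existsP[v]; rewrite negb_imply negbK => /andP[/supp vs uv].
  have uvN : enum_rank u != enum_rank v.
    by rewrite (inj_eq enum_rank_inj); apply: contraTneq uv => ->; rewrite adj_irr.
  have le : (U_(enum_rank u) + U_(enum_rank v) <= m)%MM.
    apply/mnm_lepP => k; have /mnm_lepP/(_ k) := us; have /mnm_lepP/(_ k) := vs.
    rewrite mnmDE !mnm1E; case: (eqVneq (enum_rank u) k) => [<-|_] //=.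
    by rewrite eq_sym (negPf uvN) addn0.
  rewrite -(submK le) mpolyXD scalerAl mpolyXD.
  by apply: ideal_gen_mul; left; exists u, v.
rewrite negb_forall => /existsP[v]; rewrite negb_imply negbK => /andP[/supp vs vi].
rewrite -(submK vs) mpolyXD scalerAl.
by apply: ideal_gen_mul; right; exists v.
Qed.

Lemma acyclic_index_face (W : {set 'I_n}) r :
  acyclic K [pred t : {set 'I_n} | (t \subset W) && index_face t] r <->
  acyclic K (face_in (vertex_of @: W)) r.
Proof.
rewrite (acyclic_transport K vertex_of_inj (D := face_in (vertex_of @: W))); last first.
  move=> t _; exists (vertex_of @^-1: t); apply/setP=> v.
  apply/idP/imsetP => [vt|[i]]; last by rewrite inE => it ->.
  by exists (enum_rank v); rewrite ?inE vertex_of_rank.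
apply: eq_acyclic => t; rewrite /face_in /=; congr (_ && _).
apply/idP/idP; first exact: imsetS.
move=> /subsetP h; apply/subsetP=> x xt; have := h (vertex_of x).
by rewrite !(mem_imset _ _ vertex_of_inj); apply.
Qed.

(** Hochster's formula, as a criterion for nonvanishing.  It holds for the generators of
    each minimal resolution, hence for those counted by the Betti number, and there is
    something to count because a minimal resolution exists. *)
Lemma betti_neq0 i j : betti (@edge_ideal K G) i j <> 0%N <->
  exists W : {set G}, [/\ #|W| = j, (i <= j)%N & ~ acyclic K (face_in W) (j - i)].
Proof.
have [F0 F0min] := exists_minimal_resolution K index_face_down index_face0.
have torE : betti (@edge_ideal K G) i j <> 0%N <->
    ~ tor_ideal (sr_ideal index_face : S -> Prop) i j.
  rewrite edge_idealE /betti.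
  have [F [Fmin ->]] := epsilon_spec (inhabits 0%N) (fun b =>
    exists F : free_seq K n, minimal_resolution (sr_ideal index_face) F /\
      b = #|[set k : 'I_(frank F i) | fdeg k == j]|)
    (ex_intro _ _ (ex_intro _ F0 (conj F0min erefl))).
  rewrite (fdeg_tor index_face_down i j Fmin); split=> [c0 none|some c0].
    case: c0; apply: eq_card0 => k; rewrite inE; apply/negbTE/eqP/none.
  apply: some => k kj; have : k \in [set k : 'I_(frank F i) | fdeg k == j] by rewrite inE kj.
  by rewrite (cards0_eq c0) inE.
rewrite torE; split=> [ntor|[W [Wj ij nac]] tor].
  apply: NNPP => none; apply: ntor; apply: tor_ideal_of_acyclic => W Wj ij.
  apply: NNPP => nac; apply: none; exists (vertex_of @: W); split=> //.
    by rewrite card_imset //; apply: vertex_of_inj.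
  by move/acyclic_index_face.
apply: nac; have WE : W = vertex_of @: (vertex_of @^-1: W).
  apply/setP=> v; apply/idP/imsetP => [vW|[k]]; last by rewrite inE => kW ->.
  by exists (enum_rank v); rewrite ?inE vertex_of_rank.
rewrite WE; apply/acyclic_index_face; apply: (acyclic_of_tor_ideal index_face_down tor) => //.
by rewrite -Wj [in RHS]WE card_imset //; apply: vertex_of_inj.
Qed.

(** A face with [r] vertices in the restriction to [W] accounts for
    [i = #|W| - r] and [j = #|W|], so that [j - i = r]. *)
Lemma reg_homological r : homological K G r -> (forall r', homological K G r' -> (r' <= r)%N) ->
  reg (@edge_ideal K G) = r%:Z.
Proof.
move=> hr rmax; pose P (s : int) := exists i j : nat,
  betti (@edge_ideal K G) i j <> 0%N /\ s = j%:Z - i%:Z.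
have PE s : P s <-> exists2 q, homological K G q & s = q%:Z.
  split=> [[i [j [/betti_neq0[W [Wj ij nac]] ->]]]|[q [W nac] ->]].
    by exists (j - i)%N; [exists W|rewrite subzn].
  have qW : (q <= #|W|)%N.
    rewrite leqNgt; apply/negP => lt; apply: nac; apply: acyclic_card => t.
    case/andP=> /subset_leq_card tW _.
    by apply: contraTneq lt => <-; rewrite -leqNgt.
  exists (#|W| - q)%N, #|W|; split; last by rewrite -subzn // opprB addrC subrK.
  apply/betti_neq0; exists W; split=> //; first exact: leq_subr.
  by rewrite subKn.
have maxr : is_max P r.
  split; first by apply/PE; exists r.
  by move=> s /PE[q /rmax qr ->]; rewrite lez_nat.
rewrite /reg; have [Pe emax] := epsilon_spec (inhabits 0) (is_max P) (ex_intro _ _ maxr).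
apply/eqP; rewrite eq_le; apply/andP; split; first exact: maxr.2.
by apply: emax; apply: maxr.1.
Qed.

Lemma homological0 : homological K G 0.
Proof.
exists set0 => /(eq_acyclic _ _ (face_in_nonisolated _)); rewrite set0D.
exact: nonacyclic_set0.
Qed.

Lemma homological_le_card r : homological K G r -> (r <= #|G|)%N.
Proof.
move=> [W nac]; rewrite leqNgt; apply/negP => lt; apply: nac; apply: acyclic_card => t _.
by apply: contraTneq lt => <-; rewrite -leqNgt max_card.
Qed.

End EdgeIdeal.

Lemma bounded_max (P : nat -> Prop) N r : P r -> (forall q, P q -> (q <= N)%N) ->
  exists r0, P r0 /\ forall q, P q -> (q <= r0)%N.
Proof.
move=> Pr PN; have [d] : exists d, (N - r <= d)%N by exists (N - r)%N.
elim: d r Pr => [|d IH] r Pr rd.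
  by exists r; split=> // q /PN; lia.
have [[q [Pq rq]]|none] := classic (exists q, P q /\ (r < q)%N).
  by apply: (IH q Pq); have := PN q Pq; lia.
exists r; split=> // q Pq; rewrite leqNgt; apply/negP => rq; apply: none; by exists q.
Qed.

Theorem theorem2p34 (K : fieldType) (n : nat) (H : sgraph)
    (hn : (1 <= n)%N) (hH : (0 < #|H|)%N) :
  reg (@edge_ideal K (corona (star n) H)) =
    if null_graph H then n%:Z
    else (n.+1)%:Z * reg (@edge_ideal K H).
Proof.
have [r0 [hr0 r0max]] := bounded_max (homological0 K H) (@homological_le_card K H).
have [hR Rmax] := star_corona_top hn hH hr0 r0max.
rewrite (reg_homological hR Rmax) (reg_homological hr0 r0max).
by case: ifP => // _; rewrite PoszM.
Qed.
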